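(* Let $C(\mathbb{S}^{2n-1}_\theta)$ be the $(2n-1)$-dimensional $\theta$-deformed sphere whose generators $Z_1,\ldots,Z_n$ pairwise anticommute ($Z_jZ_l=-Z_lZ_j$ for $j\neq l$). Then the antipodal action of $\mathbb{Z}/2\mathbb{Z}$ generated by $Z_j\mapsto -Z_j$ has both local-triviality dimension and spectral count equal to $1$.
   Context: For an antisymmetric matrix $\theta\in M_k(\mathbb{R})$, the $\theta$-deformed sphere is the universal unital $C^*$-algebra $$C(\mathbb{S}^{2k-1}_\theta) := C^*\Big( Z_1, \ldots, Z_k \ \Big|\ [Z_j, Z_j^*] = 0,\ Z_j Z_l = e^{2 \pi i \theta_{lj}}Z_l Z_j,\ \sum_{j=1}^k Z_j Z_j^* = 1\Big).$$ An action of the finite abelian group $\mathbb{Z}/2\mathbb{Z}$ on a unital $C^*$-algebra $A$ is identified with a coaction of the compact quantum group $H=C(\mathbb{Z}/2\mathbb{Z})$. Local-triviality dimension: for a coaction $\delta$ of a compact quantum group $(H,\Delta)$ on a unital $C^*$-algebra $A$, it is the infimum (with $\inf\varnothing=\infty$) of the set of integers $d\geq 0$ such that there exist $H$-equivariant, completely positive, contractive, order zero linear maps $\gamma_0,\ldots,\gamma_d:H\to A$ with $\sum_{j=0}^d\gamma_j(1)=1$. (Order zero: $\gamma(a)\gamma(b)=0$ for positive $a,b$ with $ab=0$.) Spectral count: for an action of $\mathbb{Z}/2\mathbb{Z}$ on $A$ generated by the order two automorphism $\alpha$, let $A_{-1}=\{a\in A:\alpha(a)=-a\}$ be the spectral subspace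 of the nontrivial character; the spectral count is the infimum of the set of integers $m\geq 0$ such that there exist $a_0,b_0,\ldots,a_m,b_m\in A_{-1}$ with $\sum_{i=0}^m a_ib_i^*$ invertible.
   Formalization: The formal theorem assumes n ≥ 2; for n = 1 (the circle) the generator Z_1 is odd with Z_1 Z_1* = 1, so the spectral count is 0 and the claim fails, and for n = 0 the algebra is zero. *)

(* Defs.v *)
From HB Require Import structures.
From mathcomp Require Import all_boot all_order all_algebra all_fingroup.
From mathcomp Require Import complex.
From mathcomp Require Import all_classical all_reals all_analysis.

Set Implicit Arguments.
Unset Strict Implicit.
Unset Printing Implicit Defensive.

Import Order.TTheory GRing.Theory Num.Theory.
Import numFieldNormedType.Exports.

Local Open Scope classical_set_scope.
Local Open Scope ring_scope.
Local Open Scope complex_scope.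

(* The modulus of a complex number, as a real number; the norm of the
   [numClosedFieldType] R[i] takes its values in R[i]. *)
Definition modulus (R : realType) (z : R[i]) : R := ComplexField.Normc.normc z.

(* As in MathComp's [algType], the zero algebra is excluded. It is a terminal
   object, so leaving it out does not affect the universal property below. *)
HB.mixin Record hasStar (R : realType) A of GRing.Algebra R[i] A := {
  star : A -> A;
  starK : involutive star;
  starD : {morph star : x y / x + y};
  starZ : forall (c : R[i]) (x : A), star (c *: x) = Num.conj c *: star x;
  starM : forall x y : A, star (x * y) = star y * star x
}.

#[short(type="starAlgType")]
HB.structure Definition StarAlgebra (R : realType) :=
  {A of GRing.Algebra R[i] A & hasStar R A}.

(* [completeNormedModType] cannot be joined with [algType]: their only common
   extensions in the hierarchy are numeric domains. Hence the norm and its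
   completeness are spelled out. *)
HB.mixin Record isCStar (R : realType) A of StarAlgebra R A := {
  cnorm : A -> R;
  cnormD : forall x y : A, cnorm (x + y) <= cnorm x + cnorm y;
  cnormZ : forall (c : R[i]) (x : A), cnorm (c *: x) = modulus c * cnorm x;
  cnorm0_eq0 : forall x : A, cnorm x = 0 -> x = 0;
  cnormM : forall x y : A, cnorm (x * y) <= cnorm x * cnorm y;
  cnorm_star : forall x : A, cnorm (star x * x) = cnorm x ^+ 2;
  cnorm_complete : forall u : nat -> A,
    (forall e : R, 0 < e -> exists N : nat, forall m n : nat,
       (N <= m)%N -> (N <= n)%N -> cnorm (u m - u n) < e) ->
    exists l : A, forall e : R, 0 < e -> exists N : nat, forall n : nat,
       (N <= n)%N -> cnorm (u n - l) < e
}.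

#[short(type="cstarAlgType")]
HB.structure Definition CStarAlgebra (R : realType) :=
  {A of StarAlgebra R A & isCStar R A}.

Section maps.
Variable R : realType.

Definition is_star_hom (A B : cstarAlgType R) (f : A -> B) :=
  [/\ linear f, f 1 = 1, {morph f : x y / x * y} & {morph f : x / star x}].

Definition positive (A : starAlgType R) (x : A) := exists y, x = star y * y.

Definition starmx (A : starAlgType R) m (M : 'M[A]_m) : 'M[A]_m :=
  (map_mx star M)^T.

Definition positive_mx (A : starAlgType R) m (M : 'M[A]_m) :=
  exists N : 'M[A]_m, M = starmx N *m N.

Definition completely_positive (H A : cstarAlgType R) (f : H -> A) :=
  forall m (M : 'M[H]_m), positive_mx M -> positive_mx (map_mx f M).

Definition contractive (H A : cstarAlgType R) (f : H -> A) :=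
  forall x, cnorm (f x) <= cnorm x.

Definition order_zero (H A : cstarAlgType R) (f : H -> A) :=
  forall a b : H, positive a -> positive b -> a * b = 0 -> f a * f b = 0.

End maps.

Definition Cfun (R : realType) (G : finGroupType) := {ffun G -> R[i]}.

Section Cfun.
Variables (R : realType) (G : finGroupType).
Local Notation T := (Cfun R G).

HB.instance Definition _ := GRing.Lmodule.on T.
HB.instance Definition _ := GRing.PzRing.on T.
HB.instance Definition _ :=
  GRing.PzSemiRing_isNonZero.Build T (@ffun1_nonzero _ _ 1%g).

Fact scaleAl (k : R[i]) (u v : T) : k *: (u * v) = (k *: u) * v.
Proof. by apply/ffunP => g; rewrite !ffunE /GRing.scale/= mulrA. Qed.

HB.instance Definition _ := GRing.Lmodule_isLalgebra.Build R[i] T scaleAl.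

Fact scaleAr (k : R[i]) (u v : T) : k *: (u * v) = u * (k *: v).
Proof. by apply/ffunP => g; rewrite !ffunE /GRing.scale/= mulrCA. Qed.

HB.instance Definition _ := GRing.Lalgebra_isAlgebra.Build R[i] T scaleAr.

Definition Cfun_star (u : T) : T := [ffun g => Num.conj (u g)].

Fact Cfun_starK : involutive Cfun_star.
Proof. by move=> u; apply/ffunP => g; rewrite !ffunE conjCK. Qed.

Fact Cfun_starD : {morph Cfun_star : u v / u + v}.
Proof. by move=> u v; apply/ffunP => g; rewrite !ffunE rmorphD. Qed.

Fact Cfun_starZ (c : R[i]) (u : T) :
  Cfun_star (c *: u) = Num.conj c *: Cfun_star u.
Proof. by apply/ffunP => g; rewrite !ffunE /GRing.scale/= rmorphM. Qed.

Fact Cfun_starM (u v : T) : Cfun_star (u * v) = Cfun_star v * Cfun_star u.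
Proof. by apply/ffunP => g; rewrite !ffunE rmorphM mulrC. Qed.

HB.instance Definition _ :=
  hasStar.Build R T Cfun_starK Cfun_starD Cfun_starZ Cfun_starM.

Definition supnorm (u : T) : R := \big[Num.max/0]_g modulus (u g).

Lemma modulusE (z : R[i]) : (modulus z)%:C = `|z|.
Proof. by rewrite normc_def; case: z. Qed.

Lemma modulus_ge0 (z : R[i]) : 0 <= modulus z.
Proof. by case: z => a b; exact: sqrtr_ge0. Qed.

Lemma modulusM (z t : R[i]) : modulus (z * t) = modulus z * modulus t.
Proof. exact: ComplexField.Normc.normcM. Qed.

Lemma modulusD (z t : R[i]) : modulus (z + t) <= modulus z + modulus t.
Proof. exact: le_normcD. Qed.

Lemma supnorm_ge (u : T) g : modulus (u g) <= supnorm u.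
Proof. exact: le_bigmax. Qed.

Lemma supnorm_ge0 (u : T) : 0 <= supnorm u.
Proof. exact: bigmax_ge_id. Qed.

Lemma supnorm_le (u : T) (c : R) :
  0 <= c -> (forall g, modulus (u g) <= c) -> supnorm u <= c.
Proof. by move=> c0 uc; apply: bigmax_le. Qed.

Lemma supnorm_lt (u : T) (c : R) :
  0 < c -> (forall g, modulus (u g) < c) -> supnorm u < c.
Proof. by move=> c0 uc; apply: bigmax_lt. Qed.

Fact supnormD (u v : T) : supnorm (u + v) <= supnorm u + supnorm v.
Proof.
apply: supnorm_le => [|g]; first by rewrite addr_ge0// supnorm_ge0.
by rewrite ffunE (le_trans (modulusD _ _))// lerD// supnorm_ge.
Qed.

Fact supnormZ (c : R[i]) (u : T) : supnorm (c *: u) = modulus c * supnorm u.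
Proof.
have le_c d v : supnorm (d *: v) <= modulus d * supnorm v.
  apply: supnorm_le => [|g].
    by rewrite mulr_ge0// ?supnorm_ge0// modulus_ge0.
  by rewrite ffunE modulusM ler_wpM2l// ?modulus_ge0// supnorm_ge.
apply/le_anti; rewrite le_c /=; have [->|c0] := eqVneq c 0.
  by rewrite [modulus 0]ComplexField.Normc.normc0 mul0r supnorm_ge0.
have c0' : 0 < modulus c by rewrite -ltcR modulusE normr_gt0.
rewrite -ler_pdivlMl// -[X in X * _]ComplexField.Normc.normcV.
by rewrite -{1}[u](scalerK c0) le_c.
Qed.

Fact supnorm0_eq0 (u : T) : supnorm u = 0 -> u = 0.
Proof.
move=> u0; apply/ffunP => g; rewrite ffunE.
apply: ComplexField.Normc.eq0_normc; apply/le_anti.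
by rewrite -{1}u0 supnorm_ge modulus_ge0.
Qed.

Fact supnormM (u v : T) : supnorm (u * v) <= supnorm u * supnorm v.
Proof.
apply: supnorm_le => [|g]; first by rewrite mulr_ge0// supnorm_ge0.
by rewrite ffunE modulusM ler_pM// ?modulus_ge0// supnorm_ge.
Qed.

Fact supnorm_star (u : T) : supnorm (star u * u) = supnorm u ^+ 2.
Proof.
have E g : modulus ((star u * u) g) = modulus (u g) ^+ 2.
  rewrite !ffunE modulusM expr2; congr (_ * _).
  by apply: complexI; rewrite !modulusE norm_conjC.
apply/le_anti/andP; split.
  apply: supnorm_le => [|g]; first by rewrite exprn_ge0// supnorm_ge0.
  by rewrite E lerXn2r ?nnegrE ?modulus_ge0 ?supnorm_ge0// supnorm_ge.
rewrite -(sqr_sqrtr (supnorm_ge0 (star u * u))).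
rewrite lerXn2r ?nnegrE ?sqrtr_ge0 ?supnorm_ge0//.
apply: supnorm_le => [|g]; first exact: sqrtr_ge0.
rewrite -(ger0_norm (modulus_ge0 (u g))) -sqrtr_sqr.
by rewrite ler_wsqrtr// -E supnorm_ge.
Qed.

Fact modulus_Re (z : R[i]) : `|complex.Re z| <= modulus z.
Proof. by rewrite -lecR modulusE normc_ge_Re. Qed.

Fact modulus_Im (z : R[i]) : `|complex.Im z| <= modulus z.
Proof.
by case: z => a b; rewrite -sqrtr_sqr ler_wsqrtr// lerDr sqr_ge0.
Qed.

Fact modulus_le (z : R[i]) : modulus z <= `|complex.Re z| + `|complex.Im z|.
Proof.
case: z => a b; rewrite -[leRHS]ger0_norm ?addr_ge0// -[leRHS]sqrtr_sqr.
rewrite ler_wsqrtr// sqrrD !real_normK ?num_real// lerD2r lerDl.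
by rewrite mulrn_wge0// mulr_ge0.
Qed.

Fact real_complete (a : nat -> R) :
  (forall e : R, 0 < e -> exists N : nat, forall m n : nat,
     (N <= m)%N -> (N <= n)%N -> `|a m - a n| < e) -> cvgn a.
Proof.
move=> ca; apply/cauchy_cvgP/cauchy_exP => e e0.
have [N aN] := ca _ e0.
by exists (a N); exists N => // n /= Nn; rewrite /ball/= aN.
Qed.

Fact supnorm_complete (u : nat -> T) :
  (forall e : R, 0 < e -> exists N : nat, forall m n : nat,
     (N <= m)%N -> (N <= n)%N -> supnorm (u m - u n) < e) ->
  exists l : T, forall e : R, 0 < e -> exists N : nat, forall n : nat,
     (N <= n)%N -> supnorm (u n - l) < e.
Proof.
move=> cu.
have cRe g : cvgn (fun n => complex.Re (u n g)).
  apply: real_complete => e /cu[N uN]; exists N => m n Nm Nn.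
  apply: le_lt_trans (uN m n Nm Nn); apply: le_trans (supnorm_ge _ g).
  by apply: le_trans (modulus_Re _); rewrite !ffunE raddfB.
have cIm g : cvgn (fun n => complex.Im (u n g)).
  apply: real_complete => e /cu[N uN]; exists N => m n Nm Nn.
  apply: le_lt_trans (uN m n Nm Nn); apply: le_trans (supnorm_ge _ g).
  by apply: le_trans (modulus_Im _); rewrite !ffunE raddfB.
exists [ffun g => limn (fun n => complex.Re (u n g)) +i*
                  limn (fun n => complex.Im (u n g))] => e e0.
have e20 : 0 < e / 2 by rewrite divr_gt0.
suff [N _ uN] : \forall n \near \oo, forall g,
    `|limn (fun n => complex.Re (u n g)) - complex.Re (u n g)| < e / 2 /\
    `|limn (fun n => complex.Im (u n g)) - complex.Im (u n g)| < e / 2.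
  exists N => n /uN {}uN; apply: supnorm_lt => // g; rewrite !ffunE.
  have [uRe uIm] := uN g.
  rewrite (le_lt_trans (modulus_le _))// [ltRHS]splitr !raddfB/=.
  by rewrite ltrD// distrC.
apply: filter_forall => g; apply: filterI.
- by move: (cRe g) => /cvgrPdist_lt /(_ _ e20).
- by move: (cIm g) => /cvgrPdist_lt /(_ _ e20).
Qed.

HB.instance Definition _ := isCStar.Build R T supnormD supnormZ supnorm0_eq0
  supnormM supnorm_star supnorm_complete.

End Cfun.

(* The infimum of a set of natural numbers, with value +oo on the empty set. *)
Definition inf_nat (R : realType) (S : set nat) : \bar R :=
  ereal_inf [set (d%:R)%:E | d in S].

Section local_triviality.
Variables (R : realType) (G : finGroupType) (A : cstarAlgType R).
Variable act : G -> A -> A.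

(* For finite G, the tensor product of an algebra B with C(G) is the algebra
   of functions from G to B. Thus [coaction] maps A to the tensor product of A
   and C(G), and [comult], given by u |-> ((x, g) |-> u (x * g)), maps C(G) to
   its tensor square with the second variable as the outer one. *)
Definition coaction (a : A) : {ffun G -> A} := [ffun g => act g a].

Definition comult (u : Cfun R G) : {ffun G -> Cfun R G} :=
  [ffun g => [ffun x => u (x * g)%g]].

Definition equivariant (f : Cfun R G -> A) :=
  forall u, coaction (f u) = [ffun g => f (comult u g)].

Definition ltdim_le (d : nat) :=
  exists f : 'I_d.+1 -> Cfun R G -> A,
    (forall j, [/\ linear (f j), equivariant (f j),
       completely_positive (f j), contractive (f j) & order_zero (f j)]) /\
    \sum_j f j 1 = 1.

Definition ltdim : \bar R := inf_nat R [set d | ltdim_le d].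

End local_triviality.

Section Z2.
Variables (R : realType) (A : cstarAlgType R) (alpha : A -> A).

Definition Z2_act (g : 'Z_2) : A -> A := iter g alpha.

Definition invertible (x : A) := exists y, x * y = 1 /\ y * x = 1.

Definition odd_part : set A := [set a | alpha a = - a].

Definition spectral_count : \bar R :=
  inf_nat R [set m : nat | exists a b : 'I_m.+1 -> A,
    (forall i, odd_part (a i) /\ odd_part (b i)) /\
    invertible (\sum_i a i * star (b i))].

End Z2.

Section theta_sphere.
Variables (R : realType) (k : nat) (theta : 'M[R]_k).

(* exp (2 * pi * i * t) *)
Definition phase (t : R) : R[i] := cos (2 * pi * t) +i* sin (2 * pi * t).

Definition theta_sphere_rel (A : cstarAlgType R) (Z : 'I_k -> A) :=
  [/\ forall j, Z j * star (Z j) = star (Z j) * Z j,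
      forall j l, Z j * Z l = phase (theta l j) *: (Z l * Z j) &
      \sum_j Z j * star (Z j) = 1].

Definition is_theta_sphere (A : cstarAlgType R) (Z : 'I_k -> A) :=
  theta_sphere_rel Z /\
  forall (B : cstarAlgType R) (W : 'I_k -> B), theta_sphere_rel W ->
    exists! f : A -> B, is_star_hom f /\ forall j, f (Z j) = W j.

Definition is_antipodal (A : cstarAlgType R) (Z : 'I_k -> A) (alpha : A -> A) :=
  is_star_hom alpha /\ forall j, alpha (Z j) = - Z j.

Lemma antipodal_exists (A : cstarAlgType R) (Z : 'I_k -> A) :
  is_theta_sphere Z -> exists! alpha, is_antipodal Z alpha.
Proof.
have starN (x : A) : star (- x) = - star x.
  by rewrite -scaleN1r starZ rmorphN rmorph1 scaleN1r.
move=> [[Zn Zc Z1] Zu]; apply: Zu; split => [j|j l|].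
- by rewrite starN !mulrNN Zn.
- by rewrite !mulrNN Zc.
- by rewrite -[RHS]Z1; apply: eq_bigr => j _; rewrite starN mulrNN.
Qed.

Lemma antipodal_involutive (A : cstarAlgType R) (Z : 'I_k -> A) alpha :
  is_theta_sphere Z -> is_antipodal Z alpha -> involutive alpha.
Proof.
move=> [Zr Zu] [[al a1 aM aS] aZ]; have [f [_ uf]] := Zu A Z Zr.
suff e : alpha \o alpha = id by move=> x; rewrite -[LHS]/((alpha \o alpha) x) e.
rewrite -(uf id) ?(uf (alpha \o alpha))//; split => [|j /=].
- split=> [c x y||x y|x] /=; first by rewrite !al.
  + by rewrite !a1.
  + by rewrite !aM.
  + by rewrite !aS.
- have aN x : alpha (- x) = - alpha x.
    have := al (-1) x x; rewrite !scaleN1r !addNr => a0.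
    by have := al (-1) x 0; rewrite a0 !scaleN1r !addr0.
  by rewrite aZ aN aZ opprK.
Qed.

End theta_sphere.

(* Main.v *)
Require Import Defs.
From HB Require Import structures.
From mathcomp Require Import all_boot all_order all_algebra all_fingroup.
From mathcomp Require Import complex.
From mathcomp Require Import all_classical all_reals all_analysis.
From mathcomp Require Import lra ring.

(** Upper bounds. Let S be the sum of the generators, X its real part and Y its
    imaginary part. If the generators anticommute with each other's adjoints
    too, then in S S^* + S^* S only the diagonal terms survive, so that
    X^2 + Y^2 = (S S^* + S^* S) / 2 = 1. Both X and Y are odd, which gives
    spectral count at most 1. For the local-triviality dimension, split
    X = X_+ - X_-; the order two automorphism exchanges X_+ and X_-, so
    u |-> u(0) X_+^2 + u(1) X_-^2 is an equivariant completely positive order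
    zero map taking 1 to X^2; the maps made from X and from Y sum to 1 at the
    unit. It is contractive because X^2 + Y^2 = 1 forces the norm of X to be at
    most 1.

    That Z_j anticommutes with Z_l^* is an instance of the Fuglede-Putnam
    theorem, but on a sphere it has a purely algebraic reason
    ([sphere_star_comm]): the defects D_j = Z_j^* Z_l - conj(lam_j) Z_l Z_j^*,
    where Z_j Z_l = lam_j Z_l Z_j, satisfy sum_j D_j^* D_j = 0, because
    sum_j Z_j Z_j^* = 1. The vanishing of each D_j is [sum_mul_star_eq0].

    The C*-algebra theory needed for this is small, and everything is derived
    from the square root of 1 - a for a of norm at most 1 ([sqrt_one_sub]). If a
    and b are commuting self-adjoint elements with a^2 + b^2 = 1, then a + ib is
    unitary; with b a square root of 1 - a^2 this yields the contractivity of
    *-homomorphisms, the estimate |1 - 2 a^2| <= 1, and hence a notion of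
    positivity ([psd]) under which squares are stable under sums and sums have
    square roots. Neither spectra nor states occur.

    Lower bounds. An equivariant order zero map of mass 1 consists of two
    complementary projections exchanged by the automorphism; their difference
    is odd with square 1. So both bounds say that a b^* is never invertible for
    odd a and b. For x = (x1, x2) on the unit sphere of C^2 let pi_x be the
    representation on 2 x 2 matrices with Z_0 |-> x1 sigma_1,
    Z_1 |-> x2 (i sigma_2), and Z_j |-> 0 for other j. Conjugation by sigma_3
    implements the antipodal map, so pi_x(a) is antidiagonal for odd a; write
    b(x) for its upper right entry. Then b is odd in x, and bounded away from 0
    when a has a right inverse. It is also uniformly continuous in x: this
    property defines a closed *-subalgebra containing the generators, and such
    a subalgebra is everything by the universal property
    ([theta_sphere_generated]). But a two-sphere admits no odd map to the
    punctured plane. This last fact is proved on a grid ([odd_grid_false]):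
    along the equator the square roots of the quotients of neighbouring values
    of an odd map multiply to -1, along the parallel at the pole they multiply
    to 1, and the product is the same along neighbouring parallels. *)

Set Implicit Arguments.
Unset Strict Implicit.
Unset Printing Implicit Defensive.

Import Order.TTheory GRing.Theory Num.Theory.
Import numFieldNormedType.Exports.

Local Open Scope classical_set_scope.
Local Open Scope ring_scope.
Local Open Scope complex_scope.

(** * Moduli of complex numbers and norms in C*-algebras *)

Section modulus.
Variable R : realType.

Lemma modulus_eq0 (z : R[i]) : modulus z = 0 -> z = 0.
Proof. exact: ComplexField.Normc.eq0_normc. Qed.

Lemma modulus0 : modulus 0 = 0 :> R.
Proof. exact: ComplexField.Normc.normc0. Qed.

Lemma modulusN (z : R[i]) : modulus (- z) = modulus z.
Proof. by apply: complexI; rewrite !modulusE normrN. Qed.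

Lemma modulusB (z t : R[i]) : modulus (z - t) = modulus (t - z).
Proof. by rewrite -modulusN opprB. Qed.

Lemma modulus1 : modulus 1 = 1 :> R.
Proof. by apply: complexI; rewrite modulusE normr1. Qed.

Lemma modulus_gt0 (z : R[i]) : z != 0 -> 0 < modulus z.
Proof. by move=> z0; rewrite -ltcR modulusE normr_gt0. Qed.

Lemma modulusV (z : R[i]) : modulus z^-1 = (modulus z)^-1.
Proof. exact: ComplexField.Normc.normcV. Qed.

Lemma conj_real (r : R) : Num.conj (r%:C) = r%:C.
Proof. exact: conjc_real. Qed.

Lemma modulus_real (r : R) : modulus r%:C = `|r|.
Proof. by apply: complexI; rewrite modulusE normc_def /= expr0n addr0 sqrtr_sqr. Qed.

Lemma mul_conj (z : R[i]) : Num.conj z * z = (modulus z ^+ 2)%:C.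
Proof. by rewrite mulrC -normCK -modulusE rmorphXn. Qed.

End modulus.

Section cstar_theory.
Variables (R : realType) (A : cstarAlgType R).
Implicit Types (x y a b : A) (u : nat -> A).

Lemma starE_real (r : R) x : star (r%:C *: x) = r%:C *: star x.
Proof. by rewrite starZ conj_real. Qed.

Lemma starN x : star (- x) = - star x.
Proof. by rewrite -scaleN1r starZ rmorphN rmorph1 scaleN1r. Qed.

Lemma starB x y : star (x - y) = star x - star y.
Proof. by rewrite starD starN. Qed.

Lemma star0 : star 0 = 0 :> A.
Proof. by have := starB 0 0; rewrite !subrr. Qed.

Lemma star1 : star 1 = 1 :> A.
Proof. by rewrite -[LHS]mulr1 -[X in _ * X]starK -starM mulr1 starK. Qed.

Lemma star_sum I (r : seq I) (P : pred I) (F : I -> A) :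
  star (\sum_(i <- r | P i) F i) = \sum_(i <- r | P i) star (F i).
Proof. exact: (big_morph _ starD star0). Qed.

Lemma cnorm0 : cnorm (0 : A) = 0.
Proof. by rewrite -(scale0r (0 : A)) cnormZ modulus0 mul0r. Qed.

Lemma cnormN x : cnorm (- x) = cnorm x.
Proof. by rewrite -scaleN1r cnormZ modulusN modulus1 mul1r. Qed.

Lemma cnorm_ge0 x : 0 <= cnorm x.
Proof.
have := cnormD x (- x); rewrite subrr cnorm0 cnormN.
by rewrite -mulr2n -mulr_natl pmulr_rge0.
Qed.

Lemma cnorm_distC x y : cnorm (x - y) = cnorm (y - x).
Proof. by rewrite -cnormN opprB. Qed.

Lemma cnormZ_real (r : R) x : cnorm (r%:C *: x) = `|r| * cnorm x.
Proof. by rewrite cnormZ modulus_real. Qed.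

(** The C*-identity gives |y|^2 = |y^* y| <= |y^*| |y|, hence |y| <= |y^*|; the
    other inequality is this one for y^*. *)
Lemma cnormE_star x : cnorm (star x) = cnorm x.
Proof.
suff le_star y : cnorm y <= cnorm (star y).
  by apply/le_anti; rewrite le_star andbT -{2}(starK x) le_star.
have [->|/eqP y0] := eqVneq (cnorm y) 0; first exact: cnorm_ge0.
have {}y0 : 0 < cnorm y by rewrite lt0r cnorm_ge0 andbT; exact/eqP.
by rewrite -(ler_pM2r y0) -expr2 -cnorm_star cnormM.
Qed.

Lemma cnorm1 : cnorm (1 : A) = 1.
Proof.
have := cnorm_star (1 : A); rewrite star1 mulr1 => /eqP.
rewrite expr2 -{1}[cnorm 1]mulr1 -subr_eq0 -mulrBr mulf_eq0.
case/orP => /eqP; last by move/subr0_eq.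
by move/cnorm0_eq0/eqP; rewrite oner_eq0.
Qed.

Lemma cnorm_sa_sqr x : star x = x -> cnorm (x * x) = cnorm x ^+ 2.
Proof. by move=> sx; rewrite -{1}sx cnorm_star. Qed.

Lemma star_mul_eq0 x : star x * x = 0 -> x = 0.
Proof.
move=> x0; apply: cnorm0_eq0; have := cnorm_star x.
by rewrite x0 cnorm0 => /esym/eqP; rewrite expf_eq0 => /andP[_ /eqP].
Qed.

(** Convergence is spelled out because the algebra carries no topology, only a
    norm. *)
Definition ccvg u l := forall e : R, 0 < e ->
  exists N : nat, forall n, (N <= n)%N -> cnorm (u n - l) < e.

Lemma ccvg_dominated u l (v : nat -> A) m (K : R) :
  (forall n, cnorm (v n - m) <= K * cnorm (u n - l)) -> ccvg u l -> ccvg v m.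
Proof.
move=> vu ul e e0.
have K0 : 0 < `|K| + 1 by rewrite ltr_wpDl.
have [N uN] := ul _ (divr_gt0 e0 K0); exists N => n /uN.
rewrite ltr_pdivlMr//; apply: le_lt_trans; apply: le_trans (vu n) _.
rewrite mulrC ler_wpM2l ?cnorm_ge0// (le_trans (ler_norm K))//.
by rewrite lerDl.
Qed.

Lemma ccvg_unique u l m : ccvg u l -> ccvg u m -> l = m.
Proof.
move=> ul um; apply/eqP; rewrite -subr_eq0; apply/eqP/cnorm0_eq0/eqP.
rewrite eq_le cnorm_ge0 andbT; apply/ler_addgt0Pl => e e0; rewrite addr0.
have e20 : 0 < e / 2 by rewrite divr_gt0.
have [N uN] := ul _ e20; have [M uM] := um _ e20.
have := uN (maxn N M) (leq_maxl _ _); have := uM (maxn N M) (leq_maxr _ _).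
set w := u _ => wm wl.
rewrite [e]splitr -(subrKA w) (le_trans (cnormD _ _))// lerD// ltW//.
by rewrite cnorm_distC.
Qed.

Lemma ccvg_le u l (c : R) :
  (forall n, cnorm (u n) <= c) -> ccvg u l -> cnorm l <= c.
Proof.
move=> uc ul; apply/ler_addgt0Pr => e e0; have [N uN] := ul _ e0.
rewrite -[l](subrK (u N)) addrC (le_trans (cnormD _ _))// lerD// ltW//.
by rewrite cnorm_distC uN.
Qed.

Lemma ccvg_shift u l : ccvg u l -> ccvg (fun n => u n.+1) l.
Proof. by move=> ul e /ul[N uN]; exists N => n Nn; rewrite uN// ltnW. Qed.

End cstar_theory.

Section star_hom.
Variables (R : realType) (A B : cstarAlgType R) (f : A -> B).
Hypothesis fh : is_star_hom f.

Lemma hom_one : f 1 = 1. Proof. by case: fh. Qed.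
Lemma hom_mul x y : f (x * y) = f x * f y. Proof. by case: fh. Qed.
Lemma hom_star x : f (star x) = star (f x). Proof. by case: fh. Qed.

Lemma hom_add x y : f (x + y) = f x + f y.
Proof. by case: fh => fl _ _ _; rewrite -[x in LHS]scale1r fl scale1r. Qed.

Lemma hom0 : f 0 = 0.
Proof. by apply: (addIr (f 0)); rewrite -hom_add !add0r. Qed.

Lemma hom_scale (c : R[i]) x : f (c *: x) = c *: f x.
Proof. by case: fh => fl _ _ _; rewrite -[_ *: _ in LHS]addr0 fl hom0 addr0. Qed.

Lemma hom_opp x : f (- x) = - f x.
Proof. by rewrite -scaleN1r hom_scale scaleN1r. Qed.

Lemma hom_sub x y : f (x - y) = f x - f y.
Proof. by rewrite hom_add hom_opp. Qed.

Lemma hom_sum I (r : seq I) (P : pred I) (F : I -> A) :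
  f (\sum_(i <- r | P i) F i) = \sum_(i <- r | P i) f (F i).
Proof. exact: (big_morph f hom_add hom0). Qed.

End star_hom.

(** * Square roots *)

Section sqrt_iteration.
Variables (R : realType) (A : cstarAlgType R).
Implicit Types (a b c x y : A).

(** The iteration y_(n+1) = (a + y_n^2) / 2 from y_0 = 0, whose limit y solves
    (1 - y)^2 = 1 - a. Its terms are polynomials in a with nonnegative
    coefficients, so it is dominated by the same iteration at a = 1. *)
Fixpoint sqrt_iter a n : A :=
  if n is m.+1 then (2^-1)%:C *: (a + sqrt_iter a m * sqrt_iter a m) else 0.

Fixpoint sqrt_iter1 n : R :=
  if n is m.+1 then 2^-1 * (1 + sqrt_iter1 m * sqrt_iter1 m) else 0.

Local Notation t := sqrt_iter1.

Lemma sqrt_iter1_bounds n : 0 <= t n <= 1.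
Proof. by elim: n => [|n /andP[t0 t1]] /=; [lra|apply/andP; nra]. Qed.

Lemma sqrt_iter1_nondecreasing : {homo t : m n / (m <= n)%N >-> m <= n}.
Proof.
apply: homo_leq => [//||n]; first exact: le_trans.
by have /andP[] := sqrt_iter1_bounds n => /= ? ?; nra.
Qed.

Lemma cnorm_half_sqr a x (s : R) : cnorm a <= 1 -> 0 <= s -> cnorm x <= s ->
  cnorm ((2^-1)%:C *: (a + x * x)) <= 2^-1 * (1 + s * s).
Proof.
move=> a1 s0 xs; rewrite cnormZ_real ger0_norm ?invr_ge0// ler_wpM2l ?invr_ge0//.
rewrite (le_trans (cnormD _ _))// lerD//.
by rewrite (le_trans (cnormM _ _))// ler_pM// cnorm_ge0.
Qed.

Variables (a : A) (a1 : cnorm a <= 1).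
Local Notation y := (sqrt_iter a).

Lemma cnorm_sqrt_iter n : cnorm (y n) <= t n.
Proof.
elim: n => [|n IHn] /=; first by rewrite cnorm0.
by rewrite cnorm_half_sqr//; case/andP: (sqrt_iter1_bounds n).
Qed.

Lemma sqr_subE x z : x * x - z * z = x * (x - z) + (x - z) * z.
Proof. by rewrite mulrBr mulrBl addrA subrK. Qed.

Lemma cnorm_sqr_sub x z (s r : R) : cnorm x <= s -> cnorm z <= r ->
  cnorm (x * x - z * z) <= (s + r) * cnorm (x - z).
Proof.
move=> xs zr; rewrite sqr_subE (le_trans (cnormD _ _))// [leRHS]mulrDl lerD//.
  by rewrite (le_trans (cnormM _ _))// ler_wpM2r ?cnorm_ge0.
by rewrite (le_trans (cnormM _ _))// mulrC ler_wpM2r ?cnorm_ge0.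
Qed.

(** The step is (y_n^2 - y_(n-1)^2) / 2, and the norm of a difference of squares
    is at most the norm of the difference times the sum of the norms; the
    scalar iteration satisfies the same recursion with equality. *)
Lemma cnorm_sqrt_iter_step n : cnorm (y n.+1 - y n) <= t n.+1 - t n.
Proof.
elim: n => [|n IHn]; first by rewrite /= !subr0 cnorm_half_sqr// cnorm0.
have -> : t n.+2 - t n.+1 = 2^-1 * ((t n.+1 + t n) * (t n.+1 - t n)).
  have : t n.+1 = 2^-1 * (1 + t n * t n) by [].
  have -> : t n.+2 = 2^-1 * (1 + t n.+1 * t n.+1) by [].
  by move: (t n.+1) (t n) => s r ?; lra.
have -> : y n.+2 - y n.+1 = (2^-1)%:C *: (y n.+1 * y n.+1 - y n * y n).
  by rewrite -[LHS]scalerBr opprD addrACA subrr add0r.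
rewrite cnormZ_real ger0_norm ?invr_ge0// ler_wpM2l ?invr_ge0//.
apply: le_trans (cnorm_sqr_sub (cnorm_sqrt_iter _) (cnorm_sqrt_iter _)) _.
rewrite ler_wpM2l// addr_ge0//.
  by case/andP: (sqrt_iter1_bounds n.+1).
by case/andP: (sqrt_iter1_bounds n).
Qed.

Lemma cnorm_sqrt_iter_sub m n : (n <= m)%N -> cnorm (y m - y n) <= t m - t n.
Proof.
elim: m => [|m IHm]; first by rewrite leqn0 => /eqP ->; rewrite !subrr cnorm0.
rewrite leq_eqVlt => /predU1P[->|]; first by rewrite !subrr cnorm0.
rewrite ltnS => /IHm nm; rewrite -[y m.+1](subrK (y m)) -addrA.
rewrite -[t m.+1](subrK (t m)) -[in leRHS]addrA.
by rewrite (le_trans (cnormD _ _))// lerD// cnorm_sqrt_iter_step.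
Qed.

Lemma sqrt_iter_cauchy (e : R) : 0 < e -> exists N : nat, forall m n : nat,
  (N <= m)%N -> (N <= n)%N -> cnorm (y m - y n) < e.
Proof.
move=> e0; have ct : cvgn t.
  apply: nondecreasing_is_cvgn; first exact: sqrt_iter1_nondecreasing.
  by exists 1 => _ [n _ <-]; case/andP: (sqrt_iter1_bounds n).
have e20 : 0 < e / 2 by rewrite divr_gt0.
move/cvgrPdist_lt: ct => /(_ _ e20)[N _ tN]; exists N => m n.
wlog nm : m n / (n <= m)%N => [W Nm Nn|].
  by case: (leqP n m) => [/W|/ltnW/W W']; [exact|rewrite cnorm_distC W'].
move=> Nm Nn; apply: le_lt_trans (cnorm_sqrt_iter_sub nm) _.
have := tN _ Nm; have := tN _ Nn; rewrite /= !ltr_norml.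
by move=> /andP[? ?] /andP[? ?]; lra.
Qed.

Lemma sqrt_iter_cvg :
  exists l, ccvg y l /\ (1 - l) * (1 - l) = 1 - a.
Proof.
have [l yl] := cnorm_complete _ sqrt_iter_cauchy; exists l; split=> //.
have y1 n : cnorm (y n) <= 1.
  apply: le_trans (cnorm_sqrt_iter n) _.
  by case/andP: (sqrt_iter1_bounds n).
have l1 : cnorm l <= 1 := ccvg_le y1 yl.
have El : l = (2^-1)%:C *: (a + l * l).
  apply: ccvg_unique (ccvg_shift yl) _.
  apply: (@ccvg_dominated _ _ y l _ _ 1) yl => n.
  rewrite /= -scalerBr opprD addrACA subrr add0r.
  rewrite cnormZ_real ger0_norm ?invr_ge0//.
  apply: le_trans (ler_wpM2l _ (cnorm_sqr_sub (y1 n) l1)) _.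
    by rewrite invr_ge0.
  by rewrite mulrA ler_wpM2r ?cnorm_ge0//; lra.
have -> : a = l + l - l * l.
  rewrite {1 2}El -scalerDl -rmorphD/=.
  have -> : 2^-1 + 2^-1 = 1 :> R by lra.
  by rewrite scale1r addrK.
by rewrite mulrBl mul1r mulrBr mulr1 -addrA -opprD addrA.
Qed.

End sqrt_iteration.

Section sqrt.
Variables (R : realType) (A : cstarAlgType R).
Implicit Types (a b c x y : A).

Lemma star_sqrt_iter a n : star a = a -> star (sqrt_iter a n) = sqrt_iter a n.
Proof.
move=> sa; elim: n => [|n IHn] /=; first exact: star0.
by rewrite starE_real starD starM sa IHn.
Qed.

Lemma comm_sqrt_iter a c n : c * a = a * c ->
  c * sqrt_iter a n = sqrt_iter a n * c.
Proof.
move=> ca; elim: n => [|n IHn] /=; first by rewrite mulr0 mul0r.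
rewrite -scalerAr -scalerAl; congr (_ *: _).
by rewrite mulrDr mulrDl ca mulrA IHn -!mulrA IHn.
Qed.

Lemma hom_sqrt_iter (f : A -> A) a n : is_star_hom f -> f a = a ->
  f (sqrt_iter a n) = sqrt_iter a n.
Proof.
move=> fh fa; elim: n => [|n IHn] /=; first exact: hom0 fh.
by rewrite (hom_scale fh) (hom_add fh) (hom_mul fh) fa IHn.
Qed.

Lemma ccvg_star (u : nat -> A) l : ccvg u l -> ccvg (fun n => star (u n)) (star l).
Proof.
apply: (@ccvg_dominated _ _ _ _ _ _ 1) => n.
by rewrite -starB cnormE_star mul1r.
Qed.

Lemma ccvg_mull c (u : nat -> A) l : ccvg u l -> ccvg (fun n => c * u n) (c * l).
Proof.
by apply: (@ccvg_dominated _ _ _ _ _ _ (cnorm c)) => n; rewrite -mulrBr cnormM.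
Qed.

Lemma ccvg_mulr c (u : nat -> A) l : ccvg u l -> ccvg (fun n => u n * c) (l * c).
Proof.
apply: (@ccvg_dominated _ _ _ _ _ _ (cnorm c)) => n.
by rewrite -mulrBl mulrC cnormM.
Qed.

(** The square root is a limit of polynomials in a: it inherits self-adjointness
    from a, commutes with the commutant of a, and is fixed by the
    homomorphisms that fix a. *)
Lemma sqrt_one_sub a : cnorm a <= 1 -> exists b,
  [/\ b * b = 1 - a, star a = a -> star b = b,
      forall c, c * a = a * c -> c * b = b * c &
      forall f : A -> A, is_star_hom f ->
        (forall x, cnorm (f x) <= cnorm x) -> f a = a -> f b = b].
Proof.
move=> /sqrt_iter_cvg[l [al lE]]; exists (1 - l); split=> [//|sa|c ca|f fh fle fa].
  rewrite starB star1; congr (_ - _); apply: ccvg_unique (ccvg_star al) _.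
  by apply: (@ccvg_dominated _ _ _ _ _ _ 1) al => n; rewrite star_sqrt_iter ?mul1r.
  rewrite mulrBr mulrBl mulr1 mul1r; congr (_ - _).
  apply: ccvg_unique (ccvg_mull c al) _.
  apply: (@ccvg_dominated _ _ _ _ _ _ 1) (ccvg_mulr c al) => n.
  by rewrite comm_sqrt_iter// mul1r.
rewrite (hom_sub fh) (hom_one fh); congr (_ - _).
have : ccvg (fun n => f (sqrt_iter a n)) (f l).
  by apply: (@ccvg_dominated _ _ _ _ _ _ 1) al => n; rewrite -(hom_sub fh) mul1r.
move=> fl; apply: ccvg_unique fl _.
by apply: (@ccvg_dominated _ _ _ _ _ _ 1) al => n; rewrite (hom_sqrt_iter _ fh fa) mul1r.
Qed.

End sqrt.

(** * Commuting self-adjoint pairs and unitaries *)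

Section unitary.
Variables (R : realType) (A : cstarAlgType R).
Implicit Types (a b c x y z : A).

Lemma conj_i : Num.conj 'i%C = - 'i%C :> R[i].
Proof. by rewrite conjCi. Qed.

Lemma mul_ii : 'i%C * 'i%C = - 1 :> R[i].
Proof. by rewrite -expr2 sqr_i. Qed.

Lemma star_addi a b : star a = a -> star b = b ->
  star (a + 'i%C *: b) = a - 'i%C *: b.
Proof. by move=> sa sb; rewrite starD starZ conj_i sa sb scaleNr. Qed.

Lemma mul_addi_subi a b : a * b = b * a ->
  (a - 'i%C *: b) * (a + 'i%C *: b) = a * a + b * b.
Proof.
move=> ab; rewrite mulrBl !mulrDr -!scalerAl -!scalerAr ab !scalerA mul_ii.
by rewrite scaleN1r opprD opprK addrA addrK.
Qed.

Lemma sqr_add x y :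
  (x + y) * (x + y) = x * x + y * y + (x * y + y * x).
Proof. by rewrite mulrDl !mulrDr [y * x + _]addrC addrACA. Qed.

Lemma sqr_sub x y :
  (x - y) * (x - y) = x * x + y * y - (x * y + y * x).
Proof. by rewrite sqr_add mulrNN mulrN mulNr -opprD. Qed.

Lemma cnorm_half_add x y : cnorm x <= 1 -> cnorm y <= 1 ->
  cnorm ((2^-1)%:C *: (x + y)) <= 1.
Proof.
move=> x1 y1; rewrite cnormZ_real ger0_norm ?invr_ge0//.
by have := cnormD x y; lra.
Qed.

Lemma half_double x : (2^-1)%:C *: (x + x) = x.
Proof.
rewrite scalerDr -scalerDl -rmorphD/=.
have -> : 2^-1 + 2^-1 = 1 :> R by lra.
exact: scale1r.
Qed.

(** a + ib is unitary. *)
Lemma cnorm_addi a b : star a = a -> star b = b -> a * b = b * a ->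
  a * a + b * b = 1 -> cnorm (a + 'i%C *: b) = 1.
Proof.
move=> sa sb ab ab1; have := cnorm_star (a + 'i%C *: b).
rewrite star_addi// mul_addi_subi// ab1 cnorm1 => /esym/eqP.
by rewrite sqrp_eq1 ?cnorm_ge0// => /eqP.
Qed.

(** a is the average of the unitary a + ib and its adjoint. *)
Lemma cnorm_le1 a b : star a = a -> star b = b -> a * b = b * a ->
  a * a + b * b = 1 -> cnorm a <= 1.
Proof.
move=> sa sb ab ab1; have u1 := cnorm_addi sa sb ab ab1.
rewrite -(half_double a) -[X in X + a](addrK ('i%C *: b)) addrAC -addrA.
by rewrite cnorm_half_add// -?star_addi ?cnormE_star// u1.
Qed.

(** With c a square root of 1 - a^2, the element u = c + ia is unitary, and
    1 - 2 a^2 = c^2 - a^2 is the real part of u^2. *)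
Lemma cnorm_one_sub_sqr a : star a = a -> cnorm a <= 1 ->
  cnorm (1 - (a * a + a * a)) <= 1.
Proof.
move=> sa a1; have saa : star (a * a) = a * a by rewrite starM sa.
have [|c [cE /(_ saa) sc cc _]] := @sqrt_one_sub R A (a * a).
  by rewrite cnorm_sa_sqr// expr_le1// cnorm_ge0.
have ca : c * a = a * c by rewrite cc// mulrA.
have caa : c * c + a * a = 1 by rewrite cE subrK.
have u1 := cnorm_addi sc sa ca caa.
set u := c + 'i%C *: a in u1.
have su : star u = c - 'i%C *: a by exact: star_addi.
have -> : 1 - (a * a + a * a) = (2^-1)%:C *: (u * u + star u * star u).
  rewrite su sqr_add sqr_sub addrACA subrr addr0 half_double -scalerAl -scalerAr scalerA mul_ii.
  by rewrite scaleN1r cE opprD addrA.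
by rewrite cnorm_half_add// (le_trans (cnormM _ _))// ?cnormE_star u1 mulr1.
Qed.

End unitary.

(** * Contractivity of *-homomorphisms and positivity *)

Section contractive.
Variables (R : realType) (A B : cstarAlgType R).

(** For a self-adjoint of norm at most 1 let c be a square root of 1 - a^2: then
    f(a)^2 + f(c)^2 = 1, and [cnorm_le1] bounds f(a). The general case follows
    by scaling and by the C*-identity. *)
Lemma hom_contractive (f : A -> B) : is_star_hom f ->
  forall x, cnorm (f x) <= cnorm x.
Proof.
move=> fh; suff sa_le a : star a = a -> cnorm (f a) <= cnorm a.
  move=> x; rewrite -(@ler_pXn2r _ 2) ?nnegrE ?cnorm_ge0//.
  rewrite -!cnorm_star -(hom_star fh) -(hom_mul fh) sa_le//.
  by rewrite starM starK.
suff sa_le1 b : star b = b -> cnorm b <= 1 -> cnorm (f b) <= 1.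
  move=> sa; have [a0|a0] := eqVneq (cnorm a) 0.
    by rewrite (cnorm0_eq0 _ a0) (hom0 fh) !cnorm0.
  have {}a0 : 0 < cnorm a by rewrite lt0r cnorm_ge0 andbT.
  have i0 : 0 <= (cnorm a)^-1 by rewrite invr_ge0 cnorm_ge0.
  have := sa_le1 ((cnorm a)^-1%:C *: a).
  rewrite starE_real sa (hom_scale fh) !cnormZ_real ger0_norm//.
  by rewrite mulVf ?gt_eqF// lexx ler_pdivrMl// mulr1; exact.
move=> sb b1; have sbb : star (b * b) = b * b by rewrite starM sb.
have [|c [cE /(_ sbb) sc cc _]] := @sqrt_one_sub R A (b * b).
  by rewrite cnorm_sa_sqr// expr_le1// cnorm_ge0.
apply: (@cnorm_le1 _ _ (f b) (f c)); rewrite -?(hom_star fh) ?sb ?sc//.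
  by rewrite -!(hom_mul fh) cc// mulrA.
by rewrite -!(hom_mul fh) cE -(hom_add fh) addrC subrK (hom_one fh).
Qed.

End contractive.

Section psd.
Variables (R : realType) (A : cstarAlgType R).
Implicit Types (a b c x y z : A).

(** For self-adjoint a this says that the spectrum of a is nonnegative: it lies in
    the disc of radius c around c. The triangle inequality makes this form of
    positivity stable under sums without any spectral theory. *)
Definition psd a := star a = a /\ exists c : R, cnorm (c%:C *: 1 - a) <= c.

Lemma psd0 : psd 0.
Proof. by split; [exact: star0|exists 0; rewrite scale0r subr0 cnorm0]. Qed.

Lemma psdD a b : psd a -> psd b -> psd (a + b).
Proof.
move=> [sa [c ca]] [sb [d db]]; split; first by rewrite starD sa sb.
exists (c + d); rewrite rmorphD/= scalerDl opprD addrACA.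
by rewrite (le_trans (cnormD _ _))// lerD.
Qed.

Lemma psd_sum I (r : seq I) (P : pred I) (F : I -> A) :
  (forall i, P i -> psd (F i)) -> psd (\sum_(i <- r | P i) F i).
Proof. by move=> PF; apply: big_ind => //; [exact: psd0|exact: psdD]. Qed.

Lemma psd_sqr a : star a = a -> psd (a * a).
Proof.
move=> sa; split; first by rewrite starM sa.
have [a0|a0] := eqVneq (cnorm a) 0.
  by exists 0; rewrite (cnorm0_eq0 _ a0) mul0r subr0 scale0r cnorm0.
have {}a0 : 0 < cnorm a by rewrite lt0r cnorm_ge0 andbT.
pose r := cnorm a; pose b := r^-1%:C *: a.
have aE : a = r%:C *: b.
  by rewrite scalerA -rmorphM/= divff ?gt_eqF// scale1r.
have sb : star b = b by rewrite starE_real sa.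
have b1 : cnorm b <= 1.
  by rewrite cnormZ_real ger0_norm ?invr_ge0 ?cnorm_ge0// mulVf ?gt_eqF.
exists (2^-1 * (r * r)); have c0 : 0 <= 2^-1 * (r * r) by rewrite !mulr_ge0// ltW.
have -> : (2^-1 * (r * r))%:C *: 1 - a * a =
    (2^-1 * (r * r))%:C *: (1 - (b * b + b * b)).
  rewrite scalerBr; congr (_ - _).
  rewrite mulrC rmorphM/= -scalerA half_double rmorphM/= -scalerA.
  by rewrite [in LHS]aE -scalerAl -scalerAr.
by rewrite cnormZ_real ger0_norm// ler_piMr// cnorm_one_sub_sqr.
Qed.

(** After scaling, a = c (1 - d) with d = 1 - a / c of norm at most 1. *)
Lemma psd_sqrt a : psd a -> exists b,
  [/\ star b = b, b * b = a, forall c, c * a = a * c -> c * b = b * c &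
      forall f : A -> A, is_star_hom f -> f a = a -> f b = b].
Proof.
move=> [sa [c ca]].
have c_ge0 : 0 <= c by apply: le_trans ca; exact: cnorm_ge0.
have [c0|c0] := eqVneq c 0.
  exists 0; move: ca; rewrite c0 scale0r sub0r cnormN => a0.
  have -> : a = 0 by apply: cnorm0_eq0; apply/le_anti; rewrite a0 cnorm_ge0.
  by split=> [||c'|f fh]; rewrite ?star0 ?mulr0 ?mul0r// (hom0 fh).
have {}c0 : 0 < c by rewrite lt0r c0.
pose d := 1 - c^-1%:C *: a.
have sd : star d = d by rewrite starB star1 starE_real sa.
have aE : a = c%:C *: (1 - d).
  by rewrite opprB addrC subrK scalerA -rmorphM/= divff ?gt_eqF// scale1r.
have d1 : cnorm d <= 1.
  have -> : d = c^-1%:C *: (c%:C *: 1 - a).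
    by rewrite scalerBr scalerA -rmorphM/= mulVf ?gt_eqF// scale1r.
  by rewrite cnormZ_real ger0_norm ?invr_ge0// ler_pdivrMl// mulr1.
have [s [sE /(_ sd) ss cs fs]] := sqrt_one_sub d1.
exists ((Num.sqrt c)%:C *: s); split.
- by rewrite starE_real ss.
- rewrite -scalerAl -scalerAr scalerA -rmorphM/= -expr2 sqr_sqrtr//.
  by rewrite sE -aE.
- move=> e ea; rewrite -scalerAl -scalerAr cs//.
  by rewrite mulrBr mulrBl mulr1 mul1r -scalerAl -scalerAr ea.
- move=> f fh fa; rewrite (hom_scale fh) fs//; first exact: hom_contractive.
  by rewrite (hom_sub fh) (hom_one fh) (hom_scale fh) fa.
Qed.

(** The sum of the other squares is b^2 = - F(i)^2 for some self-adjoint b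
    commuting with F(i), so F(i) + ib has (F(i) + ib)^* (F(i) + ib) = 0. *)
Lemma sum_sa_sqr_eq0 (I : finType) (F : I -> A) :
  (forall i, star (F i) = F i) -> \sum_i F i * F i = 0 -> forall i, F i = 0.
Proof.
move=> sF F0 i.
have : psd (\sum_(j | j != i) F j * F j).
  by apply: psd_sum => j _; exact: psd_sqr.
move=> /psd_sqrt[b [sb bE cb _]].
move: F0; rewrite (bigD1 i)//= -bE => F0.
have Fb : F i * b = b * F i.
  apply: cb; rewrite -bE.
  have -> : b * b = - (F i * F i) by apply/eqP; rewrite -addr_eq0 addrC F0.
  by rewrite mulrN mulNr mulrA.
have u0 : F i + 'i%C *: b = 0.
  by apply: star_mul_eq0; rewrite star_addi// mul_addi_subi.
have v0 : F i - 'i%C *: b = 0 by rewrite -star_addi// u0 star0.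
by rewrite -[LHS]half_double -[X in X + _](addrK ('i%C *: b)) addrAC -addrA u0 v0
  addr0 scaler0.
Qed.

Definition re x := (2^-1)%:C *: (x + star x).
Definition im x := (2^-1)%:C *: ('i%C *: (star x - x)).

Lemma star_re x : star (re x) = re x.
Proof. by rewrite starE_real starD starK addrC. Qed.

Lemma star_im x : star (im x) = im x.
Proof. by rewrite starE_real starZ conj_i starB starK -opprB scalerN scaleNr opprK. Qed.

(** The cross terms of the two squares cancel, although x and its adjoint need not
    commute. *)
Lemma re_im_sqr x :
  re x * re x + im x * im x = (2^-1)%:C *: (x * star x + star x * x).
Proof.
have sqrZ (c : R[i]) y : (c *: y) * (c *: y) = (c * c) *: (y * y).
  by rewrite -scalerAl -scalerAr scalerA.
rewrite /im scalerA !sqrZ mulrACA mul_ii mulrN1 scaleNr -scalerBr.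
rewrite sqr_add sqr_sub [star x * star x + _]addrC [star x * x + _]addrC.
rewrite opprB [X in X + _]addrC addrACA subrr addr0.
by rewrite -scalerA half_double.
Qed.

(** This avoids the theorem that x^* x is positive. With w_ij = x_i x_j^*, the sum
    of all w_ij w_ij^* is sum_i x_i (sum_j x_j^* x_j) x_i^* = 0. Since
    w_ij^* = w_ji, the sum of all w_ij^* w_ij is the same one, and adding the two
    turns it into a sum of squares of self-adjoint elements. *)
Lemma sum_mul_star_eq0 (I : finType) (F : I -> A) :
  \sum_i star (F i) * F i = 0 -> forall i, F i = 0.
Proof.
move=> F0 i; pose w i j := F i * star (F j).
have sw j k : star (w j k) = w k j by rewrite starM starK.
have ww0 : \sum_(ij : I * I) w ij.1 ij.2 * star (w ij.1 ij.2) = 0.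
  rewrite -(pair_bigA _ (fun j k => w j k * star (w j k)))/= big1// => j _.
  rewrite (eq_bigr (fun k => F j * (star (F k) * F k) * star (F j))).
    by rewrite -mulr_suml -mulr_sumr F0 mulr0 mul0r.
  by move=> k _; rewrite sw /w !mulrA.
have w'w0 : \sum_(ij : I * I) star (w ij.1 ij.2) * w ij.1 ij.2 = 0.
  rewrite -[RHS]ww0 (reindex_inj (h := fun ij => (ij.2, ij.1)))/=.
    by apply: eq_bigr => -[j k] _; rewrite /= !sw.
  by move=> [j k] [j' k'] [-> ->].
pose G (s : (I * I) + (I * I)) :=
  match s with inl jk => re (w jk.1 jk.2) | inr jk => im (w jk.1 jk.2) end.
have sG s : star (G s) = G s by case: s => jk; [exact: star_re|exact: star_im].
have G0 : \sum_s G s * G s = 0.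
  rewrite big_sumType/= -big_split/=.
  under eq_bigr => jk _ do rewrite re_im_sqr.
  by rewrite -scaler_sumr big_split/= ww0 w'w0 addr0 scaler0.
have := sum_sa_sqr_eq0 sG G0 (inl (i, i)).
rewrite /= /re sw half_double /w => /(congr1 star); rewrite starM starK star0.
by move=> Fi0; rewrite -[LHS]starK (@star_mul_eq0 _ _ (star (F i))) ?starK ?star0.
Qed.

End psd.

(** * The relations between generators and adjoints *)

Section sphere_relations.
Variables (R : realType) (A : cstarAlgType R) (I : finType) (Z : I -> A).
Hypothesis Z1 : \sum_j Z j * star (Z j) = 1.

(** A Fuglede-Putnam theorem for spheres. The four terms of D_j^* D_j, where D_j is
    the difference of the two sides, involve Z_j only through e_j = Z_j Z_j^*;
    summing over j they become T^* T - T^* T - T^* T + T T^* = 0. *)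
Lemma sphere_star_comm (T : A) (lam : I -> R[i]) :
    T * star T = star T * T ->
    (forall j, Num.conj (lam j) * lam j = 1) ->
    (forall j, Z j * T = lam j *: (T * Z j)) ->
  forall j, star (Z j) * T = Num.conj (lam j) *: (T * star (Z j)).
Proof.
move=> nT lam1 ZT j; apply/eqP; rewrite -subr_eq0; apply/eqP; move: j.
apply: sum_mul_star_eq0; pose e j := Z j * star (Z j).
have lam1' j : lam j * Num.conj (lam j) = 1 by rewrite mulrC.
have TZ j : star T * star (Z j) = Num.conj (lam j) *: (star (Z j) * star T).
  by rewrite -starM ZT starZ starM.
have DD j : star (star (Z j) * T - Num.conj (lam j) *: (T * star (Z j))) *
    (star (Z j) * T - Num.conj (lam j) *: (T * star (Z j))) =
    star T * e j * T - star T * T * e j - (e j * (star T * T) - T * e j * star T).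
  rewrite starB starM starZ starM conjCK starK mulrBl !mulrBr.
  congr (_ - _ - (_ - _)).
  - by rewrite !mulrA.
  - rewrite -scalerAr mulrA -[star T * Z j * T]mulrA ZT -scalerAr -scalerAl.
    by rewrite scalerA lam1 scale1r !mulrA.
  - rewrite -scalerAl -(mulrA (Z j)) (mulrA (star T)) TZ -!scalerAl -scalerAr scalerA.
    by rewrite lam1' scale1r !mulrA.
  - rewrite -scalerAr -scalerAl scalerA lam1 scale1r.
    rewrite mulrA -(mulrA (Z j)) -nT (mulrA (Z j)) ZT -!scalerAl -[_ * star T * star (Z j)]mulrA TZ.
    by rewrite -scalerAr scalerA lam1' scale1r !mulrA.
under eq_bigr => j _ do rewrite DD.
rewrite !sumrB -!mulr_suml -!mulr_sumr Z1 !mulr1 mul1r subrr add0r.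
by rewrite nT subrr oppr0.
Qed.

Hypothesis ZZ : forall j l, j != l -> star (Z l) * Z j = - (Z j * star (Z l)).
Hypothesis Zn : forall j, Z j * star (Z j) = star (Z j) * Z j.

(** In S S^* + S^* S the off-diagonal terms cancel in pairs. *)
Lemma anticomm_re_im_sqr (S := \sum_j Z j) : re S * re S + im S * im S = 1.
Proof.
rewrite re_im_sqr star_sum.
suff -> : S * (\sum_j star (Z j)) + (\sum_j star (Z j)) * S = 1 + 1.
  exact: half_double.
rewrite -Z1 -big_split /S mulr_suml mulr_sumr -big_split/=.
apply: eq_bigr => j _; rewrite mulr_sumr mulr_suml -big_split/=.
rewrite (bigD1 j)//= -Zn big1 ?addr0// => l lj.
by rewrite ZZ ?subrr// eq_sym.
Qed.

End sphere_relations.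

(** * Order zero maps from odd self-adjoint elements *)

Section orthogonal_pair.
Variables (R : realType) (A : cstarAlgType R) (y z : A).
Hypotheses (sy : star y = y) (sz : star z = z) (yz : y * z = 0) (zy : z * y = 0).

Lemma orthogonal_pair_star_mul (c0 c1 d0 d1 : R[i]) :
  star (c0 *: y + c1 *: z) * (d0 *: y + d1 *: z) =
  (Num.conj c0 * d0) *: (y * y) + (Num.conj c1 * d1) *: (z * z).
Proof.
rewrite starD !starZ sy sz mulrDl !mulrDr -!scalerAl -!scalerAr !scalerA yz zy.
by rewrite !scaler0 addr0 add0r.
Qed.

(** By the C*-identity the norm only depends on the moduli of c0 and c1. Let w(c)
    have real part |c| and modulus s; then v = w(c0) y + w(c1) z satisfies
    v^* v = s^2 (y + z)^2, so |v| <= s, and the element with coefficients |c0| and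
    |c1| is the real part of v. *)
Lemma cnorm_orthogonal_pair (c0 c1 : R[i]) (s : R) :
    cnorm (y + z) <= 1 -> modulus c0 <= s -> modulus c1 <= s ->
  cnorm (c0 *: y + c1 *: z) <= s.
Proof.
move=> yz1 c0s c1s; have s0 : 0 <= s := le_trans (modulus_ge0 _) c0s.
pose w (c : R[i]) := (modulus c)%:C + 'i%C * (Num.sqrt (s ^+ 2 - modulus c ^+ 2))%:C.
have conjw c : Num.conj (w c) = (modulus c)%:C - 'i%C * (Num.sqrt (s ^+ 2 - modulus c ^+ 2))%:C.
  by rewrite rmorphD rmorphM /= !conj_real conj_i mulNr.
have ww c : modulus c <= s -> Num.conj (w c) * w c = (s ^+ 2)%:C.
  move=> cs; rewrite conjw /w.
  set m := modulus c; set r := Num.sqrt _.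
  have -> : (m%:C - 'i%C * r%:C) * (m%:C + 'i%C * r%:C) =
      m%:C ^+ 2 - ('i%C * 'i%C) * r%:C ^+ 2 by ring.
  rewrite mul_ii mulN1r opprK -!rmorphXn -rmorphD/= sqr_sqrtr.
    by rewrite addrC subrK.
  by rewrite subr_ge0 lerXn2r ?nnegrE ?modulus_ge0.
(* The coefficients of v have modulus s, and those of a are their real parts. *)
pose v := w c0 *: y + w c1 *: z.
pose a := (modulus c0)%:C *: y + (modulus c1)%:C *: z.
have sa : star a = a by rewrite starD !starE_real sy sz.
have va : v + star v = a + a.
  rewrite starD !starZ sy sz conjw conjw addrACA -!scalerDl /w.
  by rewrite ![_ + 'i%C * _ + _]addrACA !subrr !addr0 !scalerDl [RHS]addrACA.
have v_le : cnorm v <= s.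
  rewrite -(@ler_pXn2r _ 2) ?nnegrE ?cnorm_ge0// -cnorm_star.
  rewrite orthogonal_pair_star_mul !ww// -scalerDr cnormZ_real ger0_norm ?sqr_ge0//.
  rewrite ler_piMr ?sqr_ge0//.
  have -> : y * y + z * z = (y + z) * (y + z) by rewrite sqr_add yz zy !addr0.
  by rewrite (le_trans (cnormM _ _))// mulr_ile1 ?cnorm_ge0.
have -> : cnorm (c0 *: y + c1 *: z) = cnorm a.
  apply/eqP; rewrite -(@eqrXn2 _ 2) ?cnorm_ge0// -!cnorm_star.
  by rewrite !orthogonal_pair_star_mul !conj_real !mul_conj -!rmorphM/= !expr2.
rewrite -[a]half_double -va cnormZ_real ger0_norm ?invr_ge0//.
have := cnormD v (star v); rewrite cnormE_star; lra.
Qed.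

End orthogonal_pair.

Section order_zero_map.
Variables (R : realType) (A : cstarAlgType R) (alpha : A -> A) (X : A).
Hypotheses (ah : is_star_hom alpha).
Hypotheses (sX : star X = X) (oX : odd_part alpha X) (X1 : cnorm X <= 1).

(** With b = |X|, the positive and negative parts of X are y and z, and alpha
    exchanges them because it fixes b. The map is u |-> u(0) y^2 + u(1) z^2. Its
    values factor as f(u^* v) = g(u)^* g(v) with g linear, which gives complete
    positivity. *)
Lemma ltdim_map_of_odd : exists f : Cfun R 'Z_2 -> A,
  [/\ linear f, equivariant (Z2_act alpha) f, completely_positive f,
      contractive f & order_zero f] /\ f 1 = X * X.
Proof.
have [b [sb bb cb fb]] := psd_sqrt (psd_sqr sX).
have Xb : X * b = b * X by apply: cb; rewrite mulrA.
have ab : alpha b = b by apply: fb => //; rewrite (hom_mul ah) oX mulrNN.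
pose y := (2^-1)%:C *: (b + X); pose z := (2^-1)%:C *: (b - X).
have sy : star y = y by rewrite starE_real starD sb sX.
have sz : star z = z by rewrite starE_real starB sb sX.
have yz : y * z = 0.
  rewrite -scalerAl -scalerAr mulrDl !mulrBr bb Xb.
  by rewrite subrKA subrr !scaler0.
have zy : z * y = 0.
  rewrite -scalerAl -scalerAr mulrBl !mulrDr bb Xb.
  by rewrite opprD addrACA subrKA subrr !scaler0.
have yyzz : y * y + z * z = X * X.
  rewrite -!scalerAl -!scalerAr -!scalerDr sqr_add sqr_sub addrACA subrr addr0.
  by rewrite half_double bb half_double.
have ay : alpha y = z by rewrite (hom_scale ah) (hom_add ah) ab oX.
have az : alpha z = y by rewrite (hom_scale ah) (hom_sub ah) ab oX opprK.
(* Keeps unification from unfolding y and z below. *)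
clearbody y z.
pose f (u : Cfun R 'Z_2) := u 0 *: (y * y) + u 1 *: (z * z).
pose g (u : Cfun R 'Z_2) := u 0 *: y + u 1 *: z.
have fl : linear f.
  move=> c u v; rewrite /f !ffunE !scalerDl -!scalerA scalerDr.
  by rewrite addrACA.
have f0 : f 0 = 0 by rewrite /f !ffunE !scale0r addr0.
have fD : {morph f : u v / u + v}.
  by move=> u v; rewrite -[u]scale1r fl !scale1r.
have fsum (I : Type) (r : seq I) P (F : I -> Cfun R 'Z_2) :
    f (\sum_(i <- r | P i) F i) = \sum_(i <- r | P i) f (F i).
  exact: (big_morph f fD f0).
have fg u v : f (star u * v) = star (g u) * g v.
  by rewrite (orthogonal_pair_star_mul sy sz yz zy) /f !ffunE.
have yyzz0 : y * y * (z * z) = 0 by rewrite -mulrA (mulrA y z) yz mul0r mulr0.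
have zzyy0 : z * z * (y * y) = 0 by rewrite -mulrA (mulrA z y) zy mul0r mulr0.
have syy : star (y * y) = y * y by rewrite starM sy.
have szz : star (z * z) = z * z by rewrite starM sz.
exists f; split; last by rewrite /f !ffunE !scale1r.
split=> //.
- move=> u; apply/ffunP => -[[|[|//]] i]; rewrite !ffunE /Z2_act/=.
    by congr f; apply/ffunP => x; rewrite !ffunE; congr (u _); apply: val_inj;
      rewrite /= addn0 modn_small.
  rewrite (hom_add ah) !(hom_scale ah) !(hom_mul ah) ay az addrC /f !ffunE.
  by congr (u _ *: _ + u _ *: _); apply: val_inj.
- move=> m _ [N ->]; exists (map_mx g N); apply/matrixP => i j.
  rewrite !mxE fsum; apply: eq_bigr => k _; by rewrite !mxE fg.
- move=> u; apply: cnorm_orthogonal_pair; rewrite ?supnorm_ge//.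
  by rewrite yyzz (le_trans (cnormM _ _))// mulr_ile1 ?cnorm_ge0.
- move=> u v _ _ uv0.
  have uv x : u x * v x = 0 by move/ffunP/(_ x): uv0; rewrite !ffunE.
  rewrite /f mulrDl !mulrDr -!scalerAl -!scalerAr !scalerA yyzz0 zzyy0 !uv.
  by rewrite !scaler0 !scale0r !addr0.
Qed.

End order_zero_map.

(** * Upper bounds, and the reduction of the lower bounds *)

Section anticommuting_sphere.
Variables (R : realType) (n : nat) (theta : 'M[R]_n).
Hypothesis theta_antisym : theta^T = - theta.
Hypothesis theta_anticomm : forall j l : 'I_n, j != l -> phase (theta l j) = -1.

Lemma antisym_diag j : theta j j = 0.
Proof.
have := congr1 (fun M : 'M[R]_n => M j j) theta_antisym; rewrite !mxE => /eqP.
by rewrite -addr_eq0 -mulr2n mulrn_eq0 => /eqP.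
Qed.

Lemma phase0 : phase 0 = 1 :> R[i].
Proof. by rewrite /phase mulr0 cos0 sin0. Qed.

(** The diagonal phases are 1 because an antisymmetric matrix has zero diagonal. *)
Lemma anticomm_phase j l : phase (theta l j) = if j == l then 1 else -1.
Proof.
have [->|jl] := eqVneq j l; first by rewrite antisym_diag phase0.
exact: theta_anticomm.
Qed.

Lemma anticomm_sphere_re_im_sqr (A : cstarAlgType R) (Z : 'I_n -> A) :
  theta_sphere_rel theta Z ->
  let S := \sum_j Z j in re S * re S + im S * im S = 1.
Proof.
move=> [Zn ZZ Z1]; apply: anticomm_re_im_sqr => // l j jl.
rewrite (@sphere_star_comm _ _ _ Z Z1 (Z l) (fun j => phase (theta l j)))//.
- by rewrite anticomm_phase eq_sym (negPf jl) rmorphN1 scaleN1r.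
- by move=> k; rewrite anticomm_phase; case: ifP => _;
    rewrite ?rmorphN1 ?rmorph1 ?mulrNN mulr1.
Qed.

Variables (A : cstarAlgType R) (Z : 'I_n -> A) (alpha : A -> A).
Hypotheses (hZ : theta_sphere_rel theta Z) (ha : is_antipodal Z alpha).
Let ah : is_star_hom alpha := proj1 ha.
Let S := \sum_j Z j.

Lemma antipodal_sum : alpha S = - S.
Proof.
by rewrite (hom_sum ah) -sumrN; apply: eq_bigr => j _; case: ha => _ ->.
Qed.

Lemma odd_re : odd_part alpha (re S).
Proof.
rewrite /odd_part/= (hom_scale ah) (hom_add ah) (hom_star ah) antipodal_sum.
by rewrite starN -opprD scalerN.
Qed.

Lemma odd_im : odd_part alpha (im S).
Proof.
rewrite /odd_part/= !(hom_scale ah) (hom_sub ah) (hom_star ah) antipodal_sum.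
by rewrite starN -opprD !scalerN.
Qed.

(** x and y need not commute, but x commutes with y^2 = 1 - x^2, hence with the
    square root of y^2, which may take the place of y. *)
Lemma cnorm_le1_of_sqr_add (x y : A) : star x = x -> star y = y ->
  x * x + y * y = 1 -> cnorm x <= 1.
Proof.
move=> sx sy xy1; have [b [sb bb cb _]] := psd_sqrt (psd_sqr sy).
apply: (@cnorm_le1 _ _ x b) => //; last by rewrite bb.
apply: cb; have -> : y * y = 1 - x * x by rewrite -xy1 addrC addKr.
by rewrite mulrBr mulrBl mulr1 mul1r mulrA.
Qed.

Lemma ltdim_le_1 : ltdim_le (Z2_act alpha) 1.
Proof.
have XY1 := anticomm_sphere_re_im_sqr hZ; rewrite /= -/S in XY1.
have X1 := cnorm_le1_of_sqr_add (star_re _) (star_im _) XY1.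
have Y1 := cnorm_le1_of_sqr_add (star_im _) (star_re _) (etrans (addrC _ _) XY1).
have [f [fP f1]] := ltdim_map_of_odd ah (star_re _) odd_re X1.
have [g [gP g1]] := ltdim_map_of_odd ah (star_im _) odd_im Y1.
exists (fun j => if j == ord0 then f else g); split.
  by move=> j; case: ifP.
by rewrite big_ord_recl big_ord1/= f1 g1.
Qed.

Lemma spectral_count_le_1 : exists a b : 'I_2 -> A,
  (forall i, odd_part alpha (a i) /\ odd_part alpha (b i)) /\
  invertible (\sum_i a i * star (b i)).
Proof.
pose a (j : 'I_2) := if j == ord0 then re S else im S.
exists a, a; split.
  by move=> j; rewrite /a; case: ifP => _; split; apply: odd_re || apply: odd_im.
exists 1; rewrite mulr1 mul1r big_ord_recl big_ord1 /a/= star_re star_im.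
by have XY1 := anticomm_sphere_re_im_sqr hZ; rewrite /= -/S in XY1.
Qed.

(** The images p and q of the two minimal projections are orthogonal, sum to 1 and
    are exchanged by alpha; so x = p - q is odd and x^2 = (p + q)^2 = 1. *)
Lemma spectral_count0_of_ltdim0 : ltdim_le (Z2_act alpha) 0 ->
  exists a b, [/\ odd_part alpha a, odd_part alpha b & invertible (a * star b)].
Proof.
move=> [f [/(_ ord0)[fl fe _ _ fo]]]; rewrite big_ord1.
move: (f ord0) fl fe fo => {}f fl fe fo f1.
pose d (i : 'Z_2) : Cfun R 'Z_2 := [ffun x => (x == i)%:R].
have dpos i : positive (d i).
  exists (d i); apply/ffunP => x; rewrite !ffunE.
  by case: (x == i); rewrite ?mulr1 ?mulr0 ?rmorph1.
have d01 : d 0 + d 1 = 1.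
  by apply/ffunP => -[[|[|//]] i]; rewrite !ffunE/= ?addr0 ?add0r.
have fD u v : f (u + v) = f u + f v by rewrite -[u]scale1r fl !scale1r.
have pq : f (d 0) * f (d 1) = 0.
  apply: fo => //; apply/ffunP => -[[|[|//]] i]; rewrite !ffunE/=.
    by rewrite mulr0.
  by rewrite mul0r.
have qp : f (d 1) * f (d 0) = 0.
  apply: fo => //; apply/ffunP => -[[|[|//]] i]; rewrite !ffunE/=.
    by rewrite mul0r.
  by rewrite mulr0.
have af i : alpha (f (d i)) = f (d (i + 1)).
  have := fe (d i) => /ffunP/(_ 1); rewrite !ffunE/=.
  rewrite -[X in X = _]/(alpha (f (d i))) => ->; congr f.
  apply/ffunP => x; rewrite !ffunE; congr (_%:R); congr nat_of_bool.
  by move: x i => -[[|[|//]] ?] [[|[|//]] ?].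
pose x := f (d 0) - f (d 1).
have ox : alpha x = - x.
  have two0 : 1 + 1 = 0 :> 'Z_2 by exact: val_inj.
  by rewrite (hom_sub ah) !af opprB add0r two0.
have xx : x * x = 1.
  rewrite sqr_sub pq qp addr0 subr0.
  by rewrite -[RHS]mulr1 -f1 -d01 fD sqr_add pq qp !addr0.
exists x, (star x); rewrite /odd_part/= starK (hom_star ah) ox starN; split=> //.
by rewrite xx; exists 1; rewrite mulr1.
Qed.

End anticommuting_sphere.

Lemma inf_nat_eq1 (R : realType) (S : set nat) : S 1%N -> ~ S 0%N -> inf_nat R S = 1%:E.
Proof.
move=> S1 S0; apply/le_anti/andP; split; first by apply: ereal_inf_lbound; exists 1%N.
apply: le_ereal_inf_tmp => _ [[//|d] _ <-]; by rewrite lee_fin ler1n.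
Qed.

(** * The C*-algebra of square matrices *)

Section complex_complete.
Variable R : realType.

Lemma lecR_add (a b c : R) (x y z : R[i]) :
  a%:C = x -> b%:C = y -> c%:C = z -> x <= y + z -> a <= b + c.
Proof. by move=> <- <- <-; rewrite -rmorphD lecR. Qed.

Lemma lecR_mul (a b c : R) (x y z : R[i]) :
  a%:C = x -> b%:C = y -> c%:C = z -> x <= y * z -> a <= b * c.
Proof. by move=> <- <- <-; rewrite -rmorphM lecR. Qed.

Lemma modulus_of_real (a : R) (z : R[i]) : 0 <= a -> a%:C = z -> a = modulus z.
Proof. by move=> a0 <-; rewrite modulus_real ger0_norm. Qed.

Lemma complex_complete (u : nat -> R[i]) :
  (forall e : R, 0 < e -> exists N : nat, forall m n : nat,
     (N <= m)%N -> (N <= n)%N -> modulus (u m - u n) < e) ->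
  exists l : R[i], forall e : R, 0 < e -> \forall n \near \oo, modulus (u n - l) < e.
Proof.
move=> cu.
have cRe : cvgn (fun n => complex.Re (u n)).
  apply: real_complete => e /cu[N uN]; exists N => m n Nm Nn.
  apply: le_lt_trans (uN m n Nm Nn).
  by apply: le_trans (modulus_Re _); rewrite raddfB.
have cIm : cvgn (fun n => complex.Im (u n)).
  apply: real_complete => e /cu[N uN]; exists N => m n Nm Nn.
  apply: le_lt_trans (uN m n Nm Nn).
  by apply: le_trans (modulus_Im _); rewrite raddfB.
exists (limn (fun n => complex.Re (u n)) +i* limn (fun n => complex.Im (u n))).
move=> e e0; have e20 : 0 < e / 2 by rewrite divr_gt0.
move/cvgrPdist_lt: cRe => /(_ _ e20) nRe.
move/cvgrPdist_lt: cIm => /(_ _ e20) nIm.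
apply: filterS2 nRe nIm => n uRe uIm.
rewrite (le_lt_trans (modulus_le _))// [ltRHS]splitr !raddfB/=.
by rewrite ltrD// distrC.
Qed.

End complex_complete.

Section vnorm.
Variables (R : realType) (n : nat).
Implicit Types (u v w : 'rV[R[i]]_n).
Local Notation "''[' u , v ]" := (dotmx u%R v%R) : ring_scope.
Local Notation "''[' u ]" := '[u, u] : ring_scope.

(** The Euclidean norm. Matrices act on row vectors on the right, so that
    [opnorm] below is the operator norm of this right action. *)
Definition vnorm u : R := modulus (sqrtC '[u]).

Lemma vnormE u : (vnorm u)%:C = sqrtC '[u].
Proof. by rewrite modulusE ger0_norm// sqrtC_ge0 dnorm_ge0. Qed.

Lemma vnorm_ge0 u : 0 <= vnorm u. Proof. exact: modulus_ge0. Qed.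

Lemma vnorm_sqr u : (vnorm u ^+ 2)%:C = '[u].
Proof. by rewrite rmorphXn/= vnormE sqrtCK. Qed.

Lemma vnorm_eq0 u : vnorm u = 0 -> u = 0.
Proof.
move=> u0; have := vnorm_sqr u; rewrite u0 expr0n => /esym/eqP.
by rewrite dnorm_eq0 => /eqP.
Qed.

Lemma vnormZ c u : vnorm (c *: u) = modulus c * vnorm u.
Proof.
apply/eqP; rewrite -(@eqrXn2 _ 2) ?mulr_ge0 ?vnorm_ge0 ?modulus_ge0//.
apply/eqP/complexI; rewrite vnorm_sqr dnormZ exprMn rmorphM/= vnorm_sqr.
by rewrite rmorphXn/= modulusE.
Qed.

Lemma vnorm0 : vnorm 0 = 0.
Proof. by rewrite -(scale0r 0) vnormZ modulus0 mul0r. Qed.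

Lemma vnormD u v : vnorm (u + v) <= vnorm u + vnorm v.
Proof. have [h _] := triangle_lerif (@dotmx _ n) u v.
exact: lecR_add (vnormE (u + v)) (vnormE u) (vnormE v) h. Qed.

Lemma vnorm_sum I (r : seq I) (P : pred I) (F : I -> 'rV_n) :
  vnorm (\sum_(i <- r | P i) F i) <= \sum_(i <- r | P i) vnorm (F i).
Proof.
apply: (big_ind2 (fun u (a : R) => vnorm u <= a)) => //; first by rewrite vnorm0.
by move=> u a v b ua vb; apply: le_trans (vnormD _ _) (lerD ua vb).
Qed.

Lemma vnorm_CauchySchwarz u v : modulus '[u, v] <= vnorm u * vnorm v.
Proof. have [h _] := CauchySchwarz_sqrt (@dotmx _ n) u v.
exact: lecR_mul (modulusE '[u, v]) (vnormE u) (vnormE v) h. Qed.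

Lemma dotmxE_sum u v : '[u, v] = \sum_i u 0 i * Num.conj (v 0 i).
Proof. by rewrite dotmxE mxE; apply: eq_bigr => i _; rewrite !mxE. Qed.

Lemma vnorm_entry u i : modulus (u 0 i) <= vnorm u.
Proof.
rewrite -(@ler_pXn2r _ 2) ?nnegrE ?vnorm_ge0 ?modulus_ge0// -lecR vnorm_sqr.
rewrite dotmxE_sum (bigD1 i)//= -mul_conj mulrC lerDl sumr_ge0// => j _.
exact: mul_conjC_ge0.
Qed.

Lemma vnorm_delta i : vnorm (delta_mx 0 i) = 1.
Proof.
apply/eqP; rewrite -(@eqrXn2 _ 2) ?vnorm_ge0// expr1n.
apply/eqP/complexI; rewrite vnorm_sqr dotmxE_sum (bigD1 i)//= big1.
  by rewrite !mxE !eqxx/= conjC1 mulr1 addr0.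
by move=> j ji; rewrite !mxE eqxx (negPf ji) mul0r.
Qed.

Lemma vnorm_le_sum u : vnorm u <= \sum_i modulus (u 0 i).
Proof.
rewrite {1}(row_sum_delta u) (le_trans (vnorm_sum _ _ _))// ler_sum// => i _.
by rewrite vnormZ vnorm_delta mulr1.
Qed.

End vnorm.

(** An alias of the matrix type, to carry the operator norm. *)
Definition opmx (R : realType) (n : nat) := 'M[R[i]]_n.+1.

Section opmx.
Variables (R : realType) (n : nat).
Local Notation T := (opmx R n).
Implicit Types (M N : T).

HB.instance Definition _ := GRing.Algebra.on T.

Definition adjmx M : T := (map_mx Num.conj M)^T.

Lemma adjmxK : involutive adjmx.
Proof. by move=> M; apply/matrixP => i j; rewrite !mxE conjCK. Qed.

Lemma adjmxD : {morph adjmx : M N / M + N}.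
Proof. by move=> M N; apply/matrixP => i j; rewrite !mxE rmorphD. Qed.

Lemma adjmxZ (c : R[i]) M : adjmx (c *: M) = Num.conj c *: adjmx M.
Proof. by apply/matrixP => i j; rewrite !mxE rmorphM. Qed.

Lemma adjmxM M N : adjmx (M * N) = adjmx N * adjmx M.
Proof. by rewrite /adjmx map_mxM trmx_mul. Qed.

HB.instance Definition _ := hasStar.Build R T adjmxK adjmxD adjmxZ adjmxM.

Definition opnorm M : R := sup [set vnorm (u *m M) | u in [set u | vnorm u <= 1]].

Lemma vnorm_mulmx_le_sum (u : 'rV[R[i]]_n.+1) M :
  vnorm (u *m M) <= vnorm u * \sum_i \sum_j modulus (M i j).
Proof.
rewrite mulmx_sum_row (le_trans (vnorm_sum _ _ _))// mulr_sumr ler_sum// => i _.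
rewrite vnormZ ler_pM ?modulus_ge0 ?vnorm_ge0 ?vnorm_entry//.
rewrite (le_trans (vnorm_le_sum _))// ler_sum// => j _.
by rewrite mxE.
Qed.

Lemma opnorm_has_sup M : has_sup [set vnorm (u *m M) | u in [set u | vnorm u <= 1]].
Proof.
split; first by exists (vnorm (0 *m M)), 0 => //=; rewrite vnorm0.
exists (\sum_i \sum_j modulus (M i j)) => _ [u /= u1 <-].
rewrite (le_trans (vnorm_mulmx_le_sum _ _))// ler_piMl//.
by rewrite sumr_ge0// => i _; rewrite sumr_ge0// => j _; exact: modulus_ge0.
Qed.

Lemma opnorm_ge M (u : 'rV[R[i]]_n.+1) : vnorm (u *m M) <= opnorm M * vnorm u.
Proof.
have [u0|u0] := eqVneq (vnorm u) 0.
  by rewrite (vnorm_eq0 u0) mul0mx vnorm0 mulr0.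
have {}u0 : 0 < vnorm u by rewrite lt0r u0 vnorm_ge0.
rewrite -ler_pdivrMr// mulrC.
have -> : (vnorm u)^-1 * vnorm (u *m M) = vnorm (((vnorm u)^-1%:C *: u) *m M).
  by rewrite -scalemxAl vnormZ modulus_real ger0_norm// invr_ge0 ltW.
apply: (sup_upper_bound (opnorm_has_sup M)); exists ((vnorm u)^-1%:C *: u) => //=.
by rewrite vnormZ modulus_real ger0_norm ?invr_ge0 ?vnorm_ge0// mulVf ?gt_eqF.
Qed.

Lemma opnorm_le M (c : R) : 0 <= c ->
  (forall u : 'rV[R[i]]_n.+1, vnorm (u *m M) <= c * vnorm u) -> opnorm M <= c.
Proof.
move=> c0 Mc; apply: ge_sup; first by case: (opnorm_has_sup M).
by move=> _ [u /= u1 <-]; rewrite (le_trans (Mc u))// ler_piMr.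
Qed.

Lemma opnorm_ge0 M : 0 <= opnorm M.
Proof.
rewrite -[opnorm M]mulr1 -(@vnorm_delta R n.+1 ord0).
by apply: le_trans (opnorm_ge _ _); exact: vnorm_ge0.
Qed.

Lemma opnorm_le_sum M : opnorm M <= \sum_i \sum_j modulus (M i j).
Proof.
apply: opnorm_le => [|u]; last by rewrite mulrC vnorm_mulmx_le_sum.
by rewrite sumr_ge0// => i _; rewrite sumr_ge0// => j _; exact: modulus_ge0.
Qed.

Lemma opnorm_entry M i j : modulus (M i j) <= opnorm M.
Proof.
have := vnorm_entry (row i M) j; rewrite mxE => /le_trans; apply.
by rewrite rowE -[leRHS]mulr1 -(@vnorm_delta R n.+1 i) opnorm_ge.
Qed.

Lemma opnormD M N : opnorm (M + N) <= opnorm M + opnorm N.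
Proof.
apply: opnorm_le => [|u]; first by rewrite addr_ge0 ?opnorm_ge0.
have -> : u *m (M + N) = u *m M + u *m N by exact: mulmxDr.
apply: (le_trans (vnormD _ _)).
by rewrite mulrDl; apply: lerD; exact: opnorm_ge.
Qed.

Lemma opnormZ (c : R[i]) M : opnorm (c *: M) = modulus c * opnorm M.
Proof.
have le_c d N : opnorm (d *: N) <= modulus d * opnorm N.
  apply: opnorm_le => [|u]; first by rewrite mulr_ge0 ?opnorm_ge0 ?modulus_ge0.
  by rewrite -scalemxAr vnormZ -mulrA ler_wpM2l ?modulus_ge0 ?opnorm_ge.
apply/le_anti; rewrite le_c/=; have [->|c0] := eqVneq c 0.
  by rewrite modulus0 mul0r opnorm_ge0.
rewrite -ler_pdivlMl ?modulus_gt0// -modulusV.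
by rewrite -{1}[M](scalerK c0) le_c.
Qed.

Lemma opnorm0_eq0 M : opnorm M = 0 -> M = 0.
Proof.
move=> M0; apply/matrixP => i j; rewrite mxE; apply: modulus_eq0.
by apply/le_anti; rewrite modulus_ge0 -M0 opnorm_entry.
Qed.

Lemma opnormM M N : opnorm (M * N) <= opnorm M * opnorm N.
Proof.
apply: opnorm_le => [|u]; first by rewrite mulr_ge0 ?opnorm_ge0.
have -> : u *m (M * N) = (u *m M) *m N by exact: mulmxA.
have h1 := opnorm_ge N (u *m M).
have h2 := ler_wpM2l (opnorm_ge0 N) (opnorm_ge M u).
by rewrite mulrA [opnorm N * opnorm M]mulrC in h2; exact: le_trans h1 h2.
Qed.

(** |uM|^2 = <u, u M M^*> <= |u|^2 |M M^*| by the Cauchy-Schwarz inequality. *)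
Lemma opnorm_sqr_le M : opnorm M ^+ 2 <= opnorm (M * star M).
Proof.
rewrite -[leRHS]sqr_sqrtr ?opnorm_ge0// ler_pXn2r ?nnegrE ?sqrtr_ge0 ?opnorm_ge0//.
apply: opnorm_le => [|u]; first exact: sqrtr_ge0.
rewrite -(@ler_pXn2r _ 2) ?nnegrE ?mulr_ge0 ?sqrtr_ge0 ?vnorm_ge0//.
rewrite exprMn sqr_sqrtr ?opnorm_ge0//.
have E : (vnorm (u *m M) ^+ 2)%:C = dotmx u (u *m (M * star M)).
  have adjM p (N : 'M[R[i]]_(p, n.+1)) (L : T) :
      map_mx Num.conj (N *m L)^T = adjmx L *m map_mx Num.conj N^T.
    by rewrite trmx_mul map_mxM/= /adjmx map_trmx.
  rewrite vnorm_sqr !dotmxE !adjM adjmxM [star M]/(adjmx M) adjmxK.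
  rewrite -[M * adjmx M]/(M *m adjmx M).
  by rewrite !mulmxA.
have -> : vnorm (u *m M) ^+ 2 = modulus (dotmx u (u *m (M * star M))).
  exact: modulus_of_real (sqr_ge0 _) E.
rewrite (le_trans (vnorm_CauchySchwarz _ _))// expr2 mulrA [leLHS]mulrC.
by rewrite ler_wpM2r ?vnorm_ge0 ?opnorm_ge.
Qed.

Lemma opnorm_star_mul M : opnorm (star M * M) = opnorm M ^+ 2.
Proof.
have le_star N : opnorm N <= opnorm (star N).
  have [->|N0] := eqVneq (opnorm N) 0; first exact: opnorm_ge0.
  have {}N0 : 0 < opnorm N by rewrite lt0r N0 opnorm_ge0.
  have h := le_trans (opnorm_sqr_le N) (opnormM N (star N)).
  by rewrite [opnorm N ^+ 2]expr2 (ler_pM2l N0) in h.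
have starE N : opnorm (star N) = opnorm N.
  apply/le_anti/andP; split; last exact: le_star.
  by have := le_star (star N); rewrite starK.
apply/le_anti/andP; split.
  by have := opnormM (star M) M; rewrite starE -expr2.
by have := opnorm_sqr_le (star M); rewrite starE starK.
Qed.

Lemma opnorm_complete (u : nat -> T) :
  (forall e : R, 0 < e -> exists N : nat, forall m n : nat,
     (N <= m)%N -> (N <= n)%N -> opnorm (u m - u n) < e) ->
  exists l : T, forall e : R, 0 < e -> exists N : nat, forall n : nat,
     (N <= n)%N -> opnorm (u n - l) < e.
Proof.
move=> cu.
have /choice[l lP] (ij : 'I_n.+1 * 'I_n.+1) : exists l : R[i],
    forall e : R, 0 < e -> \forall k \near \oo, modulus (u k ij.1 ij.2 - l) < e.
  apply: complex_complete => e /cu[N uN]; exists N => p q Np Nq.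
  apply: le_lt_trans (uN p q Np Nq).
  by have := opnorm_entry (u p - u q) ij.1 ij.2; rewrite !mxE.
exists (\matrix_(i, j) l (i, j)) => e e0.
pose d := e / 2 / (n.+1 * n.+1)%:R.
have d0 : 0 < d by rewrite !divr_gt0.
have [N _ uN] : \forall k \near \oo, forall ij, modulus (u k ij.1 ij.2 - l ij) < d.
  by apply: filter_forall => ij; exact: lP.
exists N => k /uN {}uN; apply: le_lt_trans (opnorm_le_sum _) _.
apply: (@le_lt_trans _ _ (\sum_(i < n.+1) \sum_(j < n.+1) d)).
  apply: ler_sum => i _; apply: ler_sum => j _; apply: ltW.
  by have := uN (i, j); rewrite !mxE.
rewrite !sumr_const !card_ord -mulrnA -mulr_natr divfK ?pnatr_eq0//.
by rewrite ltr_pdivrMr// ltr_pMr// ltr1n.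
Qed.

HB.instance Definition _ := isCStar.Build R T opnormD opnormZ opnorm0_eq0
  opnormM opnorm_star_mul opnorm_complete.

End opmx.

(** * The generators generate *)

Record closed_subalg (R : realType) (A : cstarAlgType R) := ClosedSubalg {
  closed_subalg_pred : {pred A};
  closed_subalg_subalg : GRing.subalg_closed closed_subalg_pred;
  closed_subalg_star : forall x, x \in closed_subalg_pred ->
    star x \in closed_subalg_pred;
  closed_subalg_lim : forall (u : nat -> A) l,
    (forall n, u n \in closed_subalg_pred) -> ccvg u l ->
    l \in closed_subalg_pred
}.

Record subcstar (R : realType) (A : cstarAlgType R) (S : closed_subalg A) :=
  SubCStar { subcstar_val : A; _ : subcstar_val \in closed_subalg_pred S }.

Section subcstar.
Variables (R : realType) (A : cstarAlgType R) (S : closed_subalg A).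
Local Notation T := (subcstar S).
Implicit Types x y : T.

HB.instance Definition _ := [isSub for @subcstar_val R A S].
HB.instance Definition _ := [Choice of T by <:].
HB.instance Definition _ := GRing.SubChoice_isSubAlgebra.Build R[i] A
  (closed_subalg_pred S) T (GRing.subalg_closed_semi (closed_subalg_subalg S)).

Definition substar x : T := SubCStar (closed_subalg_star (valP x)).

Lemma substarK : involutive substar.
Proof. by move=> x; apply: val_inj; rewrite /= starK. Qed.

Lemma substarD : {morph substar : x y / x + y}.
Proof. by move=> x y; apply: val_inj; rewrite /= starD. Qed.

Lemma substarZ (c : R[i]) x : substar (c *: x) = Num.conj c *: substar x.
Proof. by apply: val_inj; rewrite /= starZ. Qed.

Lemma substarM x y : substar (x * y) = substar y * substar x.
Proof. by apply: val_inj; rewrite /= starM. Qed.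

HB.instance Definition _ := hasStar.Build R T substarK substarD substarZ substarM.

Definition subnorm x : R := cnorm (val x).

Lemma subnormD x y : subnorm (x + y) <= subnorm x + subnorm y.
Proof. exact: cnormD. Qed.

Lemma subnormZ (c : R[i]) x : subnorm (c *: x) = modulus c * subnorm x.
Proof. exact: cnormZ. Qed.

Lemma subnorm0_eq0 x : subnorm x = 0 -> x = 0.
Proof. by move=> x0; apply: val_inj; exact: cnorm0_eq0. Qed.

Lemma subnormM x y : subnorm (x * y) <= subnorm x * subnorm y.
Proof. exact: cnormM. Qed.

Lemma subnorm_star x : subnorm (star x * x) = subnorm x ^+ 2.
Proof. exact: cnorm_star. Qed.

Lemma subnorm_complete (u : nat -> T) :
  (forall e : R, 0 < e -> exists N : nat, forall m n : nat,
     (N <= m)%N -> (N <= n)%N -> subnorm (u m - u n) < e) ->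
  exists l : T, forall e : R, 0 < e -> exists N : nat, forall n : nat,
     (N <= n)%N -> subnorm (u n - l) < e.
Proof.
move=> cu; have [l ul] := cnorm_complete (fun n => val (u n)) cu.
have Sl : l \in closed_subalg_pred S.
  by apply: closed_subalg_lim ul => n; exact: valP.
by exists (SubCStar Sl).
Qed.

HB.instance Definition _ := isCStar.Build R T subnormD subnormZ subnorm0_eq0
  subnormM subnorm_star subnorm_complete.

Lemma val_star_hom : is_star_hom (val : T -> A).
Proof. by []. Qed.

End subcstar.

Section theta_sphere_generated.
Variables (R : realType) (k : nat) (theta : 'M[R]_k).

Lemma star_hom_sphere_rel (A B : cstarAlgType R) (f : A -> B) (Z : 'I_k -> A) :
  is_star_hom f -> theta_sphere_rel theta Z ->
  theta_sphere_rel theta (fun j => f (Z j)).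
Proof.
move=> fh [Zn ZZ Z1]; split=> [j|j l|].
- by rewrite -!(hom_star fh) -!(hom_mul fh) Zn.
- by rewrite -!(hom_mul fh) ZZ (hom_scale fh).
- rewrite -(hom_one fh) -Z1 (hom_sum fh); apply: eq_bigr => j _.
  by rewrite (hom_mul fh) (hom_star fh).
Qed.

Variables (A : cstarAlgType R) (Z : 'I_k -> A).
Hypothesis hZ : is_theta_sphere theta Z.

(** Both maps solve the universal problem for the images of the generators. *)
Lemma theta_sphere_hom_eq (B : cstarAlgType R) (f g : A -> B) :
  is_star_hom f -> is_star_hom g -> (forall j, f (Z j) = g (Z j)) -> f = g.
Proof.
move=> fh gh fg; have [Zr Zu] := hZ.
have [h [_ uh]] := Zu B _ (star_hom_sphere_rel fh Zr).
by transitivity h; [apply/esym|]; apply: uh; split.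
Qed.

(** The universal property gives a homomorphism into the subalgebra that fixes the
    generators; composed with the inclusion it is the identity. *)
Lemma theta_sphere_generated (S : closed_subalg A) :
  (forall j, Z j \in closed_subalg_pred S) ->
  forall a, a \in closed_subalg_pred S.
Proof.
move=> SZ a; have [[Zn ZZ Z1] Zu] := hZ.
pose W j : subcstar S := SubCStar (SZ j).
have Wr : theta_sphere_rel theta W.
  split=> [j|j l|]; apply: val_inj => /=; [exact: Zn|exact: ZZ|].
  by rewrite (hom_sum (@val_star_hom _ _ S)).
have [f [[fh fZ] _]] := Zu _ W Wr.
have vf : val \o f = id.
  apply: theta_sphere_hom_eq => // [|j /=]; last by rewrite fZ.
  have [fl f1 fM fS] := fh; split=> [c x y||x y|x] /=.
  - by rewrite fl.
  - by rewrite f1.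
  - by rewrite fM.
  - by rewrite fS.
have <- : val (f a) = a := congr1 (fun h => h a) vf.
exact: valP.
Qed.

End theta_sphere_generated.

(** * A two-sphere has no odd map to the punctured plane *)

Section sqrt_near1.
Variable R : realType.
Implicit Types (w s t z : R[i]).

(** The square root of w that is closer to 1, for w near 1. *)
Definition sqrt_near1 w : R[i] :=
  let s := sqrtC w in if modulus (s - 1) <= modulus (w - 1) then s else - s.

Lemma sqrt_near1_sqr w : sqrt_near1 w ^+ 2 = w.
Proof. by rewrite /sqrt_near1; case: ifP => _; rewrite ?sqrrN sqrtCK. Qed.

(** For a square root s of w, (s - 1) (s + 1) = w - 1, and one of the two factors
    has modulus at least 1 because they differ by 2. *)
Lemma sqrt_near1_dist w : modulus (sqrt_near1 w - 1) <= modulus (w - 1).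
Proof.
rewrite /sqrt_near1; set s := sqrtC w; case: ifPn => //; rewrite -ltNge.
have -> : w - 1 = (s - 1) * (s + 1) by rewrite -(sqrtCK w) -/s; ring.
have -> : - s - 1 = - (s + 1) by ring.
rewrite modulusM modulusN => lt1.
have s1 : modulus (s + 1) < 1.
  rewrite ltNge; apply/negP => s1; move: lt1; rewrite ltNge => /negP; apply.
  by rewrite ler_peMr ?modulus_ge0.
rewrite ler_peMl ?modulus_ge0//.
have := modulusD (s + 1) (- (s - 1)).
have -> : (s + 1) + (- (s - 1)) = 1 + 1 by ring.
rewrite modulusN -[1 + 1]/(2%:R) -(rmorph_nat (real_complex R)) modulus_real ger0_norm//.
by move=> ?; lra.
Qed.

Lemma sqr_near1_inj s t : modulus (s - 1) < 1 -> modulus (t - 1) < 1 ->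
  s ^+ 2 = t ^+ 2 -> s = t.
Proof.
move=> s1 t1 /eqP; rewrite eqf_sqr => /orP[/eqP//|/eqP st].
have := modulusD (s - 1) (t - 1); rewrite st.
have -> : - t - 1 + (t - 1) = - (1 + 1) by ring.
rewrite modulusN -[1 + 1]/(2%:R) -(rmorph_nat (real_complex R)) modulus_real ger0_norm//.
by rewrite leNgt -[2]/(1 + 1 : R) ltrD// -st.
Qed.

(** Both sides are square roots of the same number lying at distance less than 1
    from 1, and there is only one such root. *)
Lemma sqrt_near1M w z w' z' :
    modulus (w - 1) <= 4^-1 -> modulus (z - 1) <= 4^-1 ->
    modulus (w' - 1) <= 4^-1 -> modulus (z' - 1) <= 4^-1 -> w * z = w' * z' ->
  sqrt_near1 w * sqrt_near1 z = sqrt_near1 w' * sqrt_near1 z'.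
Proof.
have near s t : modulus (s - 1) <= 4^-1 -> modulus (t - 1) <= 4^-1 ->
    modulus (s * t - 1) < 1.
  move=> s1 t1.
  have -> : s * t - 1 = (s - 1) * (t - 1) + (s - 1) + (t - 1) by ring.
  have := modulusD ((s - 1) * (t - 1) + (s - 1)) (t - 1).
  have := modulusD ((s - 1) * (t - 1)) (s - 1); rewrite modulusM.
  have := modulus_ge0 (s - 1); have := modulus_ge0 (t - 1).
  by move: (modulus _) (modulus _) s1 t1 => a b; nra.
move=> w1 z1 w1' z1' wz; apply: sqr_near1_inj.
- by apply: near; apply: le_trans (sqrt_near1_dist _) _.
- by apply: near; apply: le_trans (sqrt_near1_dist _) _.
- by rewrite !exprMn !sqrt_near1_sqr.
Qed.

Lemma sqrt_near1_1 : sqrt_near1 1 = 1.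
Proof.
have := sqrt_near1_dist 1; rewrite subrr modulus0 => s0.
apply/eqP; rewrite -subr_eq0; apply/eqP/modulus_eq0/le_anti.
by rewrite s0 modulus_ge0.
Qed.

End sqrt_near1.

Section grid.
Variables (R : realType) (N M : nat) (v : nat -> nat -> R[i]).
Hypothesis v0 : forall i j, v i j != 0.
Hypothesis row_near : forall i j, modulus (v i j.+1 / v i j - 1) <= 4^-1.
Hypothesis col_near : forall i j, modulus (v i.+1 j / v i j - 1) <= 4^-1.
Let a i j := sqrt_near1 (v i j.+1 / v i j).
Let b i j := sqrt_near1 (v i.+1 j / v i j).

(** The product of the roots around a small cell is trivial by [sqrt_near1M]; the
    cells between two neighbouring rows telescope. *)
Lemma grid_transport i k :
  (\prod_(j < k) a i j) * b i k = b i 0 * \prod_(j < k) a i.+1 j.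
Proof.
elim: k => [|k IHk]; first by rewrite !big_ord0 mul1r mulr1.
rewrite !big_ord_recr/= mulrA -IHk -!mulrA; congr (_ * _).
apply: sqrt_near1M => //.
have cancel (x y z : R[i]) : y != 0 -> y / x * (z / y) = z / x.
  by move=> y0; rewrite mulrC mulrA divfK.
by rewrite !cancel ?v0.
Qed.

Hypothesis periodic : forall i, v i (M + M) = v i 0%N.
Hypothesis const0 : forall j, v 0 j = v 0 0.
Hypothesis oddN : forall j, v N (j + M) = - v N j.

Lemma grid_holonomy i : \prod_(j < M + M) a i j = 1.
Proof.
elim: i => [|i IHi].
  by rewrite big1// => j _; rewrite /a !const0 divff// sqrt_near1_1.
have := grid_transport i (M + M); rewrite IHi mul1r /b !periodic -/(b i 0).
have b0 : b i 0 != 0.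
  by rewrite -sqrf_eq0 sqrt_near1_sqr mulf_neq0 ?invr_neq0.
by rewrite -[LHS]mulr1 => /(mulfI b0).
Qed.

(** Oddness makes the second half of the product over row N equal to the first
    half Q, and Q^2 telescopes to v(N, M) / v(N, 0) = -1, against the holonomy 1
    of row 0. *)
Lemma odd_grid_false : False.
Proof.
(* For M = 0 oddness would make v(N, 0) its own opposite. *)
have M0 : (0 < M)%N.
  rewrite lt0n; apply/eqP => M0; have := oddN 0; rewrite M0 addn0 => /eqP.
  by rewrite -addr_eq0 -mulr2n mulrn_eq0 (negPf (v0 _ _)).
have := grid_holonomy N; rewrite big_split_ord/=.
have -> : \prod_(j < M) a N (M + j) = \prod_(j < M) a N j.
  by apply: eq_bigr => j _; rewrite /a -addnS ![(M + _)%N]addnC !oddN invrN mulrNN.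
rewrite -expr2 -prodrXl.
have -> : \prod_(j < M) a N j ^+ 2 = -1.
  under eq_bigr => j _ do rewrite sqrt_near1_sqr.
  rewrite -(big_mkord xpredT (fun j => v N j.+1 / v N j)) telescope_prodf//.
  by rewrite (oddN 0 : v N M = _) mulNr divff.
by move/eqP; rewrite eqr_oppLR -addr_eq0 -[1 + 1]/(2%:R) pnatr_eq0.
Qed.

End grid.

Section circle.
Variable R : realType.

Definition cis (x : R) : R[i] := cos x +i* sin x.

Lemma cisX (x : R) n : cis x ^+ n = cis (x *+ n).
Proof.
elim: n => [|n IHn]; first by rewrite expr0 mulr0n /cis cos0 sin0.
rewrite exprS IHn mulrS /cis cosD sinD; apply/eqP.
by rewrite eq_complex/= eqxx/= addrC.
Qed.

Lemma modulus_cis (x : R) : modulus (cis x) = 1.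
Proof. by rewrite /modulus /= cos2Dsin2 sqrtr1. Qed.

Lemma exists_root_of_i (d : R) : 0 < d -> exists N, exists z : R[i],
  [/\ modulus z = 1, modulus (z - 1) < d & z ^+ N = 'i%C].
Proof.
move=> d0; have d20 : 0 < d / 2 by rewrite divr_gt0.
pose x n : R := pi / 2 * n.+1%:R^-1.
have x0 : x n @[n --> \oo] --> (0 : R).
  rewrite -[X in _ --> X](mulr0 (pi / 2)); apply: cvgM.
    exact: cvg_cst.
  exact: cvg_harmonic.
have c1 : cos (x n) @[n --> \oo] --> (1 : R).
  by rewrite -cos0; apply: continuous_cvg x0; exact: continuous_cos.
have s0 : sin (x n) @[n --> \oo] --> (0 : R).
  by rewrite -sin0; apply: continuous_cvg x0; exact: continuous_sin.
move/cvgrPdist_lt: c1 => /(_ _ d20) c1.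
move/cvgrPdist_lt: s0 => /(_ _ d20) s0.
have [n [cn sn]] : exists n, `|1 - cos (x n)| < d / 2 /\ `|0 - sin (x n)| < d / 2.
  by have [k _ /(_ k (leqnn k))] : \forall n \near \oo,
    `|1 - cos (x n)| < d / 2 /\ `|0 - sin (x n)| < d / 2; [near do split|exists k].
exists n.+1, (cis (x n)); split; first exact: modulus_cis.
  rewrite (le_lt_trans (modulus_le _))//= [ltRHS]splitr ltrD//.
    by rewrite distrC.
  by rewrite subr0 -normrN -sub0r.
rewrite cisX /x -[_ *+ n.+1]mulr_natr -mulrA mulVf ?pnatr_eq0// mulr1.
by rewrite /cis cos_pihalf sin_pihalf.
Unshelve. all: by end_near.
Qed.

End circle.

Section odd_map.
Variable R : realType.

Definition on_sphere (x1 x2 : R[i]) := modulus x1 ^+ 2 + modulus x2 ^+ 2 = 1.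

Lemma modulus_sqr (z : R[i]) : modulus z ^+ 2 = complex.Re z ^+ 2 + complex.Im z ^+ 2.
Proof. by case: z => a b; rewrite sqr_sqrtr// addr_ge0 ?sqr_ge0. Qed.

(** Row i of the grid is the parallel (Im(z^i) z^j, Re(z^i)), where z is a root of i
    close to 1: row 0 is a point, and row N is the equator (z^j, 0). Powers of a
    single number z near 1 thus give small steps in both directions. *)
Lemma no_odd_map (b : R[i] -> R[i] -> R[i]) (m : R) : 0 < m ->
    (forall e : R, 0 < e -> exists2 d : R, 0 < d &
       forall x1 x2 y1 y2, on_sphere x1 x2 -> on_sphere y1 y2 ->
       modulus (x1 - y1) < d -> modulus (x2 - y2) < d ->
       modulus (b x1 x2 - b y1 y2) < e) ->
    (forall x1 x2, on_sphere x1 x2 -> m <= modulus (b x1 x2)) ->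
    (forall x1 x2, on_sphere x1 x2 -> b (- x1) (- x2) = - b x1 x2) ->
  False.
Proof.
move=> m0 cb mb ob.
have [d d0 dP] := cb _ (divr_gt0 m0 (ltr0n _ 4)).
have [N [z [z1 zd zN]]] := exists_root_of_i d0.
have zk k : modulus (z ^+ k) = 1.
  by elim: k => [|k IHk]; rewrite ?modulus1// exprS modulusM z1 IHk mulr1.
have zS k : modulus (z ^+ k.+1 - z ^+ k) < d.
  by rewrite exprS -[X in _ - X]mul1r -mulrBl modulusM zk mulr1.
pose x1 i j := (complex.Im (z ^+ i))%:C * z ^+ j.
pose x2 i := (complex.Re (z ^+ i))%:C.
have xs i j : on_sphere (x1 i j) (x2 i).
  rewrite /on_sphere /x1 /x2 modulusM zk mulr1 !modulus_real !real_normK ?num_real//.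
  by rewrite addrC -modulus_sqr zk expr1n.
pose v i j := b (x1 i j) (x2 i).
have mv i j : m <= modulus (v i j) by exact/mb/xs.
have v0 i j : v i j != 0.
  by apply/eqP => vij; have := mv i j; rewrite vij modulus0 leNgt m0.
have quot i j i' j' : modulus (x1 i' j' - x1 i j) < d -> modulus (x2 i' - x2 i) < d ->
    modulus (v i' j' / v i j - 1) <= 4^-1.
  move=> h1 h2; rewrite -(divff (v0 i j)) -mulrBl modulusM modulusV.
  rewrite ler_pdivrMr ?modulus_gt0// (le_trans (ltW (dP _ _ _ _ _ _ h1 h2)))//.
  by rewrite mulrC ler_wpM2l ?invr_ge0.
apply: (@odd_grid_false R N (N + N) v) => //.
- move=> i j; apply: quot; last by rewrite subrr modulus0.
  rewrite /x1 -mulrBr modulusM modulus_real (le_lt_trans _ (zS j))//.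
  rewrite ler_piMl ?modulus_ge0// (le_trans (modulus_Im _))//.
  by rewrite zk.
- move=> i j; apply: quot.
    rewrite /x1 -mulrBl modulusM zk mulr1 -rmorphB -raddfB modulus_real.
    exact: le_lt_trans (modulus_Im _) (zS i).
  rewrite /x2 -rmorphB -raddfB modulus_real.
  exact: le_lt_trans (modulus_Re _) (zS i).
- by move=> i; rewrite /v /x1 !exprD zN mul_ii mulrNN mulr1 expr0.
- by move=> j; rewrite /v /x1 expr0 /= !mul0r.
- move=> j; have x20 : x2 N = 0 by rewrite /x2 zN.
  rewrite /v -ob ?xs// x20 oppr0; congr (b _ _).
  by rewrite /x1 !exprD zN mul_ii mulrN1 mulrN.
Qed.

End odd_map.

(** * Representations on 2 x 2 matrices and the lower bounds *)

Section uniform_continuity.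
Variables (R : realType) (A B : cstarAlgType R) (K : Type) (D : K -> Prop).
Variables (close : R -> K -> K -> Prop) (pi_ : K -> A -> B).
Hypothesis close_le : forall d d' x y, d <= d' -> close d x y -> close d' x y.
Hypothesis hom_pi : forall x, D x -> is_star_hom (pi_ x).

(** Uniform rather than pointwise continuity of a |-> pi_x(a) in x, so that the
    grid argument can be applied without compactness. *)
Definition ucont (a : A) := forall e : R, 0 < e -> exists2 d : R, 0 < d &
  forall x y, D x -> D y -> close d x y -> cnorm (pi_ x a - pi_ y a) < e.

Lemma ucont_le (a b c : A) (k l : R) : ucont a -> ucont b ->
    (forall x y, D x -> D y -> cnorm (pi_ x c - pi_ y c) <=
       k * cnorm (pi_ x a - pi_ y a) + l * cnorm (pi_ x b - pi_ y b)) ->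
  ucont c.
Proof.
move=> ca cb cc e e0; pose r := `|k| + `|l| + 1.
have r0 : 0 < r by rewrite ltr_wpDl// addr_ge0.
have er0 : 0 < e / r by rewrite divr_gt0.
have [d1 d10 ad] := ca _ er0; have [d2 d20 bd] := cb _ er0.
exists (Num.min d1 d2) => [|x y Dx Dy xy]; first by rewrite lt_min d10.
have le1 : Num.min d1 d2 <= d1 by rewrite ge_min lexx.
have le2 : Num.min d1 d2 <= d2 by rewrite ge_min lexx orbT.
have {}ad := ad x y Dx Dy (close_le le1 xy).
have {}bd := bd x y Dx Dy (close_le le2 xy).
apply: le_lt_trans (cc x y Dx Dy) _.
apply: (@le_lt_trans _ _ (`|k| * (e / r) + `|l| * (e / r))).
  apply: lerD; apply: le_trans (ler_wpM2r (cnorm_ge0 _) (ler_norm _)) _;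
    by rewrite ler_wpM2l// ltW.
by rewrite -mulrDl mulrCA gtr_pMr// ltr_pdivrMr// mul1r ltrDl.
Qed.

Lemma ucont1 : ucont 1.
Proof.
move=> e e0; exists 1 => // x y Dx Dy _.
by rewrite (hom_one (hom_pi Dx)) (hom_one (hom_pi Dy)) subrr cnorm0.
Qed.

Lemma ucont_linear (c : R[i]) a b : ucont a -> ucont b -> ucont (c *: a + b).
Proof.
move=> ca cb; apply: (ucont_le (k := modulus c) (l := 1) ca cb) => x y Dx Dy.
have [hx hy] := (hom_pi Dx, hom_pi Dy).
rewrite (hom_add hx) (hom_add hy) (hom_scale hx) (hom_scale hy) opprD addrACA.
by rewrite -scalerBr mul1r (le_trans (cnormD _ _))// cnormZ.
Qed.

Lemma ucontM a b : ucont a -> ucont b -> ucont (a * b).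
Proof.
move=> ca cb; apply: (ucont_le (k := cnorm b) (l := cnorm a) ca cb) => x y Dx Dy.
have [hx hy] := (hom_pi Dx, hom_pi Dy).
rewrite (hom_mul hx) (hom_mul hy).
have -> : pi_ x a * pi_ x b - pi_ y a * pi_ y b =
    (pi_ x a - pi_ y a) * pi_ y b + pi_ x a * (pi_ x b - pi_ y b).
  by rewrite mulrBl mulrBr [RHS]addrC subrKA.
rewrite (le_trans (cnormD _ _))// lerD// (le_trans (cnormM _ _))//.
  by rewrite mulrC ler_wpM2r ?cnorm_ge0// hom_contractive.
by rewrite ler_wpM2r ?cnorm_ge0// hom_contractive.
Qed.

Lemma ucont_star a : ucont a -> ucont (star a).
Proof.
move=> ca; apply: (ucont_le (k := 1) (l := 0) ca ca) => x y Dx Dy.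
have [hx hy] := (hom_pi Dx, hom_pi Dy).
by rewrite (hom_star hx) (hom_star hy) -starB cnormE_star mul1r mul0r addr0.
Qed.

(** All pi_x are contractive, so the estimate for u_n passes to the limit. *)
Lemma ucont_lim (u : nat -> A) l : (forall n, ucont (u n)) -> ccvg u l -> ucont l.
Proof.
move=> cu ul e e0; have e30 : 0 < e / 3 by rewrite divr_gt0.
have [n un] := ul _ e30; have {}un := un n (leqnn n).
have [d d0 dP] := cu n _ e30; exists d => // x y Dx Dy xy.
have hle z : D z -> cnorm (pi_ z (u n) - pi_ z l) < e / 3.
  move=> /hom_pi hz; rewrite -(hom_sub hz).
  exact: le_lt_trans (hom_contractive hz _) un.
have -> : pi_ x l - pi_ y l = (pi_ x l - pi_ x (u n)) +
    (pi_ x (u n) - pi_ y (u n)) + (pi_ y (u n) - pi_ y l).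
  by rewrite !subrKA.
have := hle x Dx; have := hle y Dy; have := dP x y Dx Dy xy.
have := cnormD ((pi_ x l - pi_ x (u n)) + (pi_ x (u n) - pi_ y (u n)))
  (pi_ y (u n) - pi_ y l).
have := cnormD (pi_ x l - pi_ x (u n)) (pi_ x (u n) - pi_ y (u n)).
rewrite (cnorm_distC (pi_ x (u n)) (pi_ x l)).
by lra.
Qed.

Definition ucont_subalg : closed_subalg A.
Proof.
apply: (@ClosedSubalg _ _ (fun a => `[< ucont a >])).
- split; first exact/asboolP/ucont1.
    by move=> c a b /asboolP ca /asboolP cb; exact/asboolP/ucont_linear.
  by move=> a b /asboolP ca /asboolP cb; exact/asboolP/ucontM.
- by move=> a /asboolP ca; exact/asboolP/ucont_star.
- by move=> u l cu ul; apply/asboolP; apply: (ucont_lim _ ul) => n; exact/asboolP/cu.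
Defined.

Lemma ucont_subalgP a : a \in closed_subalg_pred ucont_subalg <-> ucont a.
Proof. by split => /asboolP. Qed.

End uniform_continuity.

Section antidiagonal.
Variable R : realType.
Local Notation M2 := (opmx R 1).

Definition antidiag (p q : R[i]) : M2 :=
  \matrix_(i, j) if i == j then 0 else if i == 0 then p else q.

(** Conjugation by the diagonal matrix with entries 1 and -1. *)
Definition twist (M : M2) : M2 :=
  \matrix_(i, j) if i == j then M i j else - M i j.

Lemma ord2P (P : 'I_2 -> 'I_2 -> Prop) :
  P 0 0 -> P 0 1 -> P 1 0 -> P 1 1 -> forall i j, P i j.
Proof.
have E (i : 'I_2) : i = 0 \/ i = 1.
  by case: i => [[|[|//]] ?]; [left|right]; exact: val_inj.
by move=> P00 P01 P10 P11 i j; case: (E i) => ->; case: (E j) => ->.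
Qed.

Lemma mulM2E (M N : M2) i j : (M * N) i j = M i 0 * N 0 j + M i 1 * N 1 j.
Proof.
rewrite mxE !big_ord_recl big_ord0 addr0; congr (_ * _ + M i _ * N _ j); exact: val_inj.
Qed.

Lemma twist_star_hom : is_star_hom twist.
Proof.
split.
- by move=> c M N; apply/matrixP => i j; rewrite !mxE; case: ifP => _;
    rewrite ?opprD ?mulrN.
- by apply/matrixP => i j; rewrite !mxE; case: eqVneq => //= _; rewrite oppr0.
- move=> M N; have E (L : M2) i j : twist L i j = if i == j then L i j else - L i j.
    by rewrite mxE.
  by apply/matrixP; apply: ord2P; rewrite E !mulM2E !E/=; ring.
- by move=> M; apply/matrixP => i j; rewrite !mxE eq_sym; case: ifP => _;
    rewrite ?rmorphN.
Qed.

Lemma antidiagE p q :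
  [/\ antidiag p q 0 0 = 0, antidiag p q 0 1 = p,
      antidiag p q 1 0 = q & antidiag p q 1 1 = 0].
Proof. by split; rewrite mxE. Qed.

Lemma antidiag_mulE (p q p' q' : R[i]) (X := antidiag p q * antidiag p' q') :
  [/\ X 0 0 = p * q', X 0 1 = 0, X 1 0 = 0 & X 1 1 = q * p'].
Proof.
have [a00 a01 a10 a11] := antidiagE p q.
have [b00 b01 b10 b11] := antidiagE p' q'.
split; rewrite /X mulM2E ?a00 ?a01 ?a10 ?a11 ?b00 ?b01 ?b10 ?b11;
  by rewrite ?mulr0 ?mul0r ?addr0 ?add0r.
Qed.

Lemma star_antidiag p q : star (antidiag p q) = antidiag (Num.conj q) (Num.conj p).
Proof. by apply/matrixP; apply: ord2P; rewrite !mxE/= ?conjC0. Qed.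

Lemma antidiagB p q p' q' :
  antidiag p q - antidiag p' q' = antidiag (p - p') (q - q').
Proof. by apply/matrixP; apply: ord2P; rewrite !mxE/= ?subrr. Qed.

Lemma cnorm_antidiag p q : cnorm (antidiag p q) <= modulus p + modulus q.
Proof.
apply: le_trans (opnorm_le_sum _) _.
have [a00 a01 a10 a11] := antidiagE p q.
have l0 : lift ord0 ord0 = 1 :> 'I_2 by exact: val_inj.
rewrite !big_ord_recl !big_ord0 l0 a00 a01 a10 a11.
by rewrite modulus0 !addr0 add0r.
Qed.

Lemma antidiagN p q : - antidiag p q = antidiag (- p) (- q).
Proof. by apply/matrixP; apply: ord2P; rewrite !mxE/= ?oppr0. Qed.

Lemma twist_antidiag p q : twist (antidiag p q) = antidiag (- p) (- q).
Proof. by apply/matrixP; apply: ord2P; rewrite !mxE. Qed.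

End antidiagonal.

Section representation.
Variables (R : realType) (n : nat) (theta : 'M[R]_n.+2).
Hypothesis theta_antisym : theta^T = - theta.
Hypothesis theta_anticomm : forall j l : 'I_n.+2, j != l -> phase (theta l j) = -1.

Definition sphere_coord (x : R[i] * R[i]) (j : 'I_n.+2) : R[i] :=
  if j == ord0 then x.1 else if j == lift ord0 ord0 then x.2 else 0.

(** Z_0 goes to x1 times a symmetric antidiagonal matrix and Z_1 to x2 times an
    antisymmetric one; these two matrices anticommute. *)
Definition sphere_rep (x : R[i] * R[i]) (j : 'I_n.+2) : opmx R 1 :=
  let p := sphere_coord x j in antidiag p (if j == ord0 then p else - p).

Lemma sphere_rep_mul_star x j :
  sphere_rep x j * star (sphere_rep x j) =
    (modulus (sphere_coord x j) ^+ 2)%:C *: 1 /\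
  star (sphere_rep x j) * sphere_rep x j =
    (modulus (sphere_coord x j) ^+ 2)%:C *: 1.
Proof.
rewrite star_antidiag; set p := sphere_coord x j; set q := if _ then _ else _.
have qq : Num.conj q * q = (modulus p ^+ 2)%:C.
  by rewrite -mul_conj /q; case: ifP => //; rewrite rmorphN mulrNN.
have pp : Num.conj p * p = (modulus p ^+ 2)%:C by rewrite mul_conj.
have [X00 X01 X10 X11] := antidiag_mulE p q (Num.conj q) (Num.conj p).
have [Y00 Y01 Y10 Y11] := antidiag_mulE (Num.conj q) (Num.conj p) p q.
have E (c : R[i]) (i k : 'I_2) : (c *: (1 : opmx R 1)) i k = c * (i == k)%:R.
  by rewrite !mxE.
split; apply/matrixP; apply: ord2P; rewrite E/= ?mulr1 ?mulr0//.
- by rewrite X00 mulrC.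
- by rewrite X11 mulrC.
- by rewrite Y00.
- by rewrite Y11.
Qed.

Lemma sphere_rep_anticomm x j l : j != l ->
  sphere_rep x j * sphere_rep x l = - (sphere_rep x l * sphere_rep x j).
Proof.
move=> jl; rewrite /sphere_rep; set pj := sphere_coord x j; set pl := sphere_coord x l.
set qj := if j == _ then _ else _; set ql := if l == _ then _ else _.
have pq : pj * ql = - (pl * qj).
  rewrite /qj /ql; have [j0|j0] := eqVneq j ord0; have [l0|l0] := eqVneq l ord0.
  - by move: jl; rewrite j0 l0 eqxx.
  - by rewrite mulrN mulrC.
  - by rewrite mulrN opprK mulrC.
  rewrite !mulrN opprK mulrC; apply/eqP; rewrite -subr_eq0 -opprD oppr_eq0.
  rewrite /pj /pl /sphere_coord (negPf j0) (negPf l0).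
  case: ifP => [/eqP l1|_]; last by rewrite !mul0r addr0.
  case: ifP => [/eqP j1|_]; first by move: jl; rewrite j1 l1 eqxx.
  by rewrite !mulr0 addr0.
have [X00 X01 X10 X11] := antidiag_mulE pj qj pl ql.
have [Y00 Y01 Y10 Y11] := antidiag_mulE pl ql pj qj.
have E (M : opmx R 1) (i k : 'I_2) : (- M) i k = - M i k by rewrite mxE.
apply/matrixP; apply: ord2P; rewrite E.
- by rewrite X00 Y00.
- by rewrite X01 Y01 oppr0.
- by rewrite X10 Y10 oppr0.
- by rewrite X11 Y11 [ql * pj]mulrC pq opprK mulrC.
Qed.

Lemma sphere_rep_rel x : on_sphere x.1 x.2 ->
  theta_sphere_rel theta (sphere_rep x).
Proof.
move=> xs; split=> [j|j l|].
- by have [-> ->] := sphere_rep_mul_star x j.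
- rewrite (anticomm_phase theta_antisym theta_anticomm).
  have [->|jl] := eqVneq j l; first by rewrite scale1r.
  by rewrite scaleN1r sphere_rep_anticomm.
- under eq_bigr => j _ do rewrite (proj1 (sphere_rep_mul_star x j)).
  rewrite -scaler_suml -[RHS]scale1r; congr (_ *: _).
  rewrite !big_ord_recl big1 => [|j _].
    by rewrite /sphere_coord/= addr0 -rmorphD/= xs.
  have -> : sphere_coord x (lift ord0 (lift ord0 j)) = 0 by [].
  by rewrite modulus0 expr0n.
Qed.

(** The antipodal map is implemented by [twist] at every x, besides being
    implemented by x |-> -x ([sphere_rep_opp]); the first makes odd elements
    antidiagonal, the second makes their entries odd functions of x. *)
Lemma twist_sphere_rep x j : twist (sphere_rep x j) = - sphere_rep x j.
Proof.
by rewrite twist_antidiag antidiagN.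
Qed.

Lemma sphere_rep_opp x j : sphere_rep (- x.1, - x.2) j = - sphere_rep x j.
Proof.
rewrite -twist_sphere_rep twist_antidiag /sphere_rep.
have -> : sphere_coord (- x.1, - x.2) j = - sphere_coord x j.
  by rewrite /sphere_coord; case: ifP => // _; case: ifP => //; rewrite oppr0.
by case: ifP.
Qed.

Lemma sphere_rep_dist x y j (d : R) : 0 < d ->
  modulus (x.1 - y.1) < d -> modulus (x.2 - y.2) < d ->
  cnorm (sphere_rep x j - sphere_rep y j) <= d + d.
Proof.
move=> d0 d1 d2; rewrite antidiagB; set p := sphere_coord x j - sphere_coord y j.
have pd : modulus p <= d.
  rewrite /p /sphere_coord; case: ifP => _; first exact: ltW.
  by case: ifP => _; [exact: ltW|rewrite subr0 modulus0 ltW].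
apply: le_trans (cnorm_antidiag _ _) _; apply: lerD => //.
by case: ifP => _ //; rewrite opprK addrC modulusB.
Qed.

Variables (A : cstarAlgType R) (Z : 'I_n.+2 -> A) (alpha : A -> A).
Hypotheses (hZ : is_theta_sphere theta Z) (ha : is_antipodal Z alpha).

(** The upper right entry of pi_x(a) is an odd uniformly continuous function of x
    on the three-sphere. Its product with the lower left entry of pi_x(f), where
    f is a right inverse of a, is 1, so its modulus is at least the inverse of
    the norm of f. *)
Lemma odd_not_invertible a b : odd_part alpha a -> ~ invertible (a * star b).
Proof.
move=> oa [c [abc _]].
have {abc} : a * (star b * c) = 1 by rewrite mulrA.
set f := star b * c => af.
have [ah aZ] := ha.
have /choice[pi_ piP] (x : R[i] * R[i]) : exists f : A -> opmx R 1,
    on_sphere x.1 x.2 -> is_star_hom f /\ forall j, f (Z j) = sphere_rep x j.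
  have [xs|nxs] := pselect (on_sphere x.1 x.2); last by exists (fun=> 0) => /nxs.
  have [_ /(_ _ _ (sphere_rep_rel xs))[g [gP _]]] := hZ.
  by exists g.
pose D (x : R[i] * R[i]) := on_sphere x.1 x.2.
have pi_hom x : D x -> is_star_hom (pi_ x) by move=> /piP[].
have alpha_hom x : D x -> is_star_hom (pi_ x \o alpha).
  move=> /pi_hom[hl h1 hm hs]; have [al a1 am as_] := ah.
  split=> [k u v||u v|u] /=; by rewrite ?al ?hl ?a1 ?h1 ?am ?hm ?as_ ?hs.
(* The twist after pi_x and pi_x after alpha both change the sign of generators. *)
have twist_pi x : D x -> twist (pi_ x a) = - pi_ x a.
  move=> Dx; have [hl h1 hm hs] := pi_hom x Dx; have [tl t1 tm ts] := twist_star_hom R.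
  have tw : is_star_hom (@twist R \o pi_ x).
    by split=> [k u v||u v|u] /=; rewrite ?hl ?tl ?h1 ?t1 ?hm ?tm ?hs ?ts.
  have E : @twist R \o pi_ x = pi_ x \o alpha.
    apply: (theta_sphere_hom_eq hZ tw (alpha_hom x Dx)) => j /=.
    by rewrite aZ (hom_opp (pi_hom x Dx)) (proj2 (piP x Dx)) twist_sphere_rep.
  have := congr1 (fun h => h a) E => /= ->.
  by rewrite oa (hom_opp (pi_hom x Dx)).
have opp_pi x : D x -> pi_ (- x.1, - x.2) a = - pi_ x a.
  move=> Dx; have Dx' : D (- x.1, - x.2) by rewrite /D /on_sphere/= !modulusN.
  have E : pi_ (- x.1, - x.2) = pi_ x \o alpha.
    apply: (theta_sphere_hom_eq hZ (pi_hom _ Dx') (alpha_hom x Dx)) => j /=.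
    rewrite aZ (hom_opp (pi_hom x Dx)) (proj2 (piP x Dx)) (proj2 (piP _ Dx')).
    exact: sphere_rep_opp.
  by rewrite E /= oa (hom_opp (pi_hom x Dx)).
pose close (d : R) (x y : R[i] * R[i]) :=
  modulus (x.1 - y.1) < d /\ modulus (x.2 - y.2) < d.
have close_le d d' x y : d <= d' -> close d x y -> close d' x y.
  by move=> dd [h1 h2]; split; [apply: lt_le_trans h1 dd|apply: lt_le_trans h2 dd].
have ca : ucont D close pi_ a.
  apply/(ucont_subalgP close_le pi_hom); apply: (theta_sphere_generated hZ) => j.
  apply/(ucont_subalgP close_le pi_hom) => e e0; exists (e / 4) => [|x y Dx Dy [h1 h2]].
    by rewrite divr_gt0.
  rewrite (proj2 (piP x Dx)) (proj2 (piP y Dy)).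
  apply: le_lt_trans (sphere_rep_dist j _ h1 h2) _; first by rewrite divr_gt0.
  by lra.
have f0 : 0 < cnorm f.
  rewrite lt0r cnorm_ge0 andbT; apply/eqP => /cnorm0_eq0 f0.
  by move: af; rewrite f0 mulr0 => /esym/eqP; rewrite oner_eq0.
apply: (@no_odd_map R (fun x1 x2 => pi_ (x1, x2) a 0 1) (cnorm f)^-1).
- by rewrite invr_gt0.
- move=> e /ca[d d0 dP]; exists d => // x1 x2 y1 y2 xs ys h1 h2.
  apply: le_lt_trans (dP (x1, x2) (y1, y2) xs ys (conj h1 h2)).
  by have := opnorm_entry (pi_ (x1, x2) a - pi_ (y1, y2) a) 0 1; rewrite !mxE.
- move=> x1 x2 xs; pose x := (x1, x2); have h := pi_hom x xs.
  have a00 : pi_ x a 0 0 = 0.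
    have := congr1 (fun M : opmx R 1 => M 0 0) (twist_pi x xs); rewrite !mxE/= => /eqP.
    by rewrite -addr_eq0 -mulr2n mulrn_eq0 => /eqP.
  have E : pi_ x a 0 1 * pi_ x f 1 0 = 1.
    have := congr1 (fun M : opmx R 1 => M 0 0) (hom_mul h a f).
    by rewrite af (hom_one h) mulM2E a00 mul0r add0r mxE/= => <-.
  have m1 : modulus (pi_ x a 0 1) * modulus (pi_ x f 1 0) = 1.
    by rewrite -modulusM E modulus1.
  rewrite -[X in X <= _]mul1r ler_pdivrMr// -m1 ler_wpM2l ?modulus_ge0//.
  exact: le_trans (opnorm_entry _ _ _) (hom_contractive h f).
- move=> x1 x2 xs; have := opp_pi (x1, x2) xs => /= ->.
  by rewrite mxE.
Qed.

End representation.

(** * The antipodal action on the anticommuting sphere *)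

Theorem proposition3p21 (R : realType) (n : nat) (hn : (2 <= n)%N)
  (theta : 'M[R]_n) (theta_antisym : theta^T = - theta)
  (theta_anticomm : forall j l : 'I_n, j != l -> phase (theta l j) = -1)
  (A : cstarAlgType R) (Z : 'I_n -> A) (hZ : is_theta_sphere theta Z)
  (alpha : A -> A) (halpha : is_antipodal Z alpha) :
  ltdim (Z2_act alpha) = 1%:E /\ spectral_count alpha = 1%:E.
Proof.
case: n hn theta theta_antisym theta_anticomm Z hZ halpha => [|[|n]]// _.
move=> theta antisym anticomm Z hZ ha.
have hZr := proj1 hZ.
have odd_inv := odd_not_invertible antisym anticomm hZ ha.
split; apply: inf_nat_eq1.
- exact: (ltdim_le_1 antisym anticomm hZr ha).
- by move=> /(spectral_count0_of_ltdim0 ha)[a [b [oa _ /(odd_inv _ _ oa)]]].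
- exact: (spectral_count_le_1 antisym anticomm hZr ha).
- move=> [a [b [/(_ ord0)[oa _]]]]; rewrite big_ord1.
  exact: odd_inv.
Qed.
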